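(* Let $k$ be a field, let $(R,\mathfrak{m}_R)$ be a noetherian complete local $k$-algebra, let $I\subseteq\mathfrak{m}_R$ be an ideal of $R$ with $\mathfrak{m}_R I=(0)$, and let $\overline{R}=R/I$. Then the following are equivalent: (i) The $\overline{R}$-module $k$ is liftable to $R$. (ii) Every finitely generated $\overline{R}$-module is liftable to $R$. (iii) The natural surjection $\pi\colon R\twoheadrightarrow\overline{R}$ has a section. (iv) $R$ admits a semi-fiber product decomposition $R\cong\overline{R}\ltimes I\cong\overline{R}\ltimes_k(k\ltimes I)$.
   Context: All rings are commutative with unity. A ''$k$-algebra'' $(R,\mathfrak{m}_R)$ means a (not necessarily local or noetherian) $k$-algebra $R$ with a specified maximal ideal $\mathfrak{m}_R$ such that the composition $k\hookrightarrow R\twoheadrightarrow R/\mathfrak{m}_R$ is an isomorphism; thus $R=k\oplus\mathfrak{m}_R$ as $k$-vector spaces. It is local if $\mathfrak{m}_R$ is the unique maximal ideal of $R$. It is complete if $R$ is complete in the $\mathfrak{m}_R$-adic topology. A $k$-algebra homomorphism $f\colon(R,\mathfrak{m}_R)\to(S,\mathfrak{m}_S)$ is always assumed to satisfy $f(\mathfrak{m}_R)\subseteq\mathfrak{m}_S$. The residue ring $\overline{R}=R/I$ is a $k$-algebra with specified maximal ideal $\mathfrak{m}_{\overline{R}}=\mathfrak{m}_R/I$, and $k$ is the $\overline R$-module $\overline R/\mathfrak m_{\overline R}$. Liftability: a complex $F$ of free $\overline{R}$-modules is liftable to $R$ if there is a complex $L$ of free $R$-modules with $L\otimes_R\overline{R}\cong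 F$ as $\overline{R}$-complexes. An $\overline{R}$-module $M$ is liftable to $R$ if some $\overline{R}$-free resolution of $M$ is liftable to $R$. Section: if $f\colon R\to S$ and $g\colon S\to R$ are $k$-algebra homomorphisms with $f$ injective, $g$ surjective and $g\circ f=\mathrm{id}_R$, then $f$ is called a section of $g$ (and $g$ a retraction of $f$). Trivial extension: for a ring $B$ and a $B$-module $M$, $B\ltimes M$ is $B\oplus M$ with multiplication $(b\oplus m)(b'\oplus m')=bb'\oplus(bm'+b'm)$. Here $I$ is an $\overline{R}$-module because $I^2\subseteq\mathfrak{m}_RI=0$; in $k\ltimes I$ it is regarded as a $k$-vector space, and $k\ltimes I$ is a $k$-algebra with specified maximal ideal $I$. Semi-fiber product: let $(B,\mathfrak{m}_B)$ and $(S,\mathfrak{m}_S)$ be $k$-algebras with a $B$-action $\ast$ on $\mathfrak{m}_S$ making $\mathfrak{m}_S$ a $(B,S)$-bimodule, compatible with the $k$-structures ($\ell\ast y=\ell y$ for $\ell\in k$, and $b\ast(ys)=(b\ast y)s$ for $b\in B$, $y\in\mathfrak{m}_S$, $s\in S$). The semi-fiber product $B\ltimes_k S$ is the $k$-vector space $k\oplus\mathfrak{m}_B\oplus\mathfrak{m}_S=B\oplus\mathfrak{m}_S$ with multiplication $(b\oplus y)(b'\oplus y')=bb'\oplus(b\ast y'+b'\ast y+yy')$; its specified maximal ideal is $\mathfrak{m}_B\oplus\mathfrak{m}_S$. In $\overline{R}\ltimes_k(k\ltimes I)$ the action of $\overline{R}$ on the maximal ideal $I$ of $k\ltimes I$ is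 the $\overline{R}$-module structure of $I$. Isomorphisms in (iv) are isomorphisms of $k$-algebras. *)

(* Defs.v *)
From HB Require Import structures.
From mathcomp Require Import all_boot all_order all_algebra.
From mathcomp Require Import ssrAC generic_quotient ring_quotient.
From mathcomp Require Import freeg boolp.

Set Implicit Arguments.
Unset Strict Implicit.
Unset Printing Implicit Defensive.

Import GRing.Theory.
Local Open Scope ring_scope.
Local Open Scope quotient_scope.

(* An [idealr A] is a *proper* ideal; this loses nothing below, as the unit   *)
(* ideal is principal, and is not maximal.                                    *)

Definition maximal_ideal (A : comNzRingType) (m : idealr A) : Prop :=
  forall J : idealr A, {subset m <= J} -> {subset J <= m}.

Definition fg_ideal (A : comNzRingType) (J : idealr A) : Prop :=
  exists2 s : seq A, {subset s <= J} &
    forall x, x \in J ->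
      exists c : 'I_(size s) -> A, x = \sum_(i < size s) c i * s`_i.

Definition noetherian (A : comNzRingType) : Prop :=
  forall J : idealr A, fg_ideal J.

(* Membership in the n-th power of J: finite sums of multiples of products of *)
(* n elements of J; the 0-th power is the whole ring.                         *)
Inductive ideal_pow (A : comNzRingType) (J : {pred A}) (n : nat) : A -> Prop :=
  | IdealPow0 : ideal_pow J n 0
  | IdealPowD a (f : 'I_n -> A) x :
      (forall i, f i \in J) -> ideal_pow J n x ->
      ideal_pow J n (a * (\prod_(i < n) f i) + x).

Definition adic_cauchy (A : comNzRingType) (J : {pred A}) (u : nat -> A) :=
  forall n, exists N, forall i j,
    (N <= i)%N -> (N <= j)%N -> ideal_pow J n (u i - u j).

Definition adic_limit (A : comNzRingType) (J : {pred A}) (u : nat -> A) (l : A) :=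
  forall n, exists N, forall i, (N <= i)%N -> ideal_pow J n (u i - l).

(* Completeness includes separatedness (uniqueness of the limit).             *)
Definition adically_complete (A : comNzRingType) (J : {pred A}) : Prop :=
  forall u, adic_cauchy J u -> exists! l, adic_limit J u l.

Section IdealModule.
Variables (A : comNzRingType) (J : idealr A).

Definition ideal_of : Type := {x : A | x \in J}.
HB.instance Definition _ := SubChoice.on ideal_of.
HB.instance Definition _ := [SubChoice_isSubZmodule of ideal_of by <:].

Definition ideal_scale (a : A) (x : ideal_of) : ideal_of :=
  exist _ (a * val x) (idealMr a (valP x)).

Lemma ideal_scaleA a b x :
  ideal_scale a (ideal_scale b x) = ideal_scale (a * b) x.
Proof. by apply: val_inj; rewrite /= mulrA. Qed.
Lemma ideal_scale1 : left_id 1 ideal_scale.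
Proof. by move=> x; apply: val_inj; rewrite /= mul1r. Qed.
Lemma ideal_scaleDr : right_distributive ideal_scale +%R.
Proof. by move=> a x y; apply: val_inj; rewrite GRing.valD /= -mulrDr; congr (_ * _); exact: GRing.valD. Qed.
Lemma ideal_scaleDl x : {morph ideal_scale^~ x : a b / a + b}.
Proof. by move=> a b; apply: val_inj; rewrite GRing.valD /= mulrDl. Qed.

HB.instance Definition _ := GRing.Zmodule_isLmodule.Build A ideal_of
  ideal_scaleA ideal_scale1 ideal_scaleDr ideal_scaleDl.

Lemma val_idealZ a (x : ideal_of) : val (a *: x) = a * val x.
Proof. by []. Qed.

End IdealModule.

Definition restr (A B : nzRingType) (phi : {rmorphism A -> B})
  (M : lmodType B) : Type := M.

Section Restr.
Variables (A B : nzRingType) (phi : {rmorphism A -> B}) (M : lmodType B).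
Local Notation T := (restr phi M).
HB.instance Definition _ := GRing.Zmodule.on T.

Definition restr_scale (a : A) (x : T) : T := phi a *: (x : M).

Lemma restr_scaleA a b x :
  restr_scale a (restr_scale b x) = restr_scale (a * b) x.
Proof. by rewrite /restr_scale scalerA rmorphM. Qed.
Lemma restr_scale1 : left_id 1 restr_scale.
Proof. by move=> x; rewrite /restr_scale rmorph1 scale1r. Qed.
Lemma restr_scaleDr : right_distributive restr_scale +%R.
Proof. by move=> a x y; rewrite /restr_scale scalerDr. Qed.
Lemma restr_scaleDl x : {morph restr_scale^~ x : a b / a + b}.
Proof. by move=> a b; rewrite /restr_scale rmorphD scalerDl. Qed.

HB.instance Definition _ := GRing.Zmodule_isLmodule.Build A T
  restr_scaleA restr_scale1 restr_scaleDr restr_scaleDl.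

Lemma restr_scaleE (a : A) (x : T) : a *: x = phi a *: (x : M).
Proof. by []. Qed.
End Restr.

Definition killed_by (A : comNzRingType) (I : idealr A) (M : lmodType A) :=
  forall (a : A) (x : M), a \in I -> a *: x = 0.

Definition quot_module (A : comNzRingType) (I : idealr A) (M : lmodType A)
  (killM : killed_by I M) : Type := M.

Section QuotModule.
Variables (A : comNzRingType) (I : idealr A) (M : lmodType A).
Variable killM : killed_by I M.
Local Notation T := (quot_module killM).
HB.instance Definition _ := GRing.Zmodule.on T.

Definition quot_scale (q : {ideal_quot I}) (x : T) : T := repr q *: (x : M).

Lemma quot_scaleE a x : quot_scale (\pi a) x = a *: (x : M).
Proof.
apply/eqP; rewrite -subr_eq0 /quot_scale -scalerBl; apply/eqP/killM.
by rewrite Quotient.idealrBE reprK.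
Qed.

Lemma quot_scaleA a b x : quot_scale a (quot_scale b x) = quot_scale (a * b) x.
Proof.
by elim/quotW: a => a; elim/quotW: b => b; rewrite -rmorphM !quot_scaleE scalerA.
Qed.
Lemma quot_scale1 : left_id 1 quot_scale.
Proof. by move=> x; rewrite -(rmorph1 \pi_{ideal_quot I}) quot_scaleE scale1r. Qed.
Lemma quot_scaleDr : right_distributive quot_scale +%R.
Proof. by move=> a x y; rewrite /quot_scale scalerDr. Qed.
Lemma quot_scaleDl x : {morph quot_scale^~ x : a b / a + b}.
Proof.
move=> a b; elim/quotW: a => a; elim/quotW: b => b.
by rewrite -rmorphD !quot_scaleE scalerDl.
Qed.

HB.instance Definition _ := GRing.Zmodule_isLmodule.Build {ideal_quot I} T
  quot_scaleA quot_scale1 quot_scaleDr quot_scaleDl.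
End QuotModule.

Section Tensor.
Variables (A S : comNzRingType) (phi : {rmorphism A -> S}) (L : lmodType A).

Local Notation F := {freeg (L * S)%type / int}.
Local Notation gen x s := (<< (x, s) >> : F).

Inductive tensor_rel : F -> Prop :=
  | TensorRel0 : tensor_rel 0
  | TensorRelB u v : tensor_rel u -> tensor_rel v -> tensor_rel (u - v)
  | TensorRelDl x y s : tensor_rel (gen (x + y) s - (gen x s + gen y s))
  | TensorRelDr x s t : tensor_rel (gen x (s + t) - (gen x s + gen x t))
  | TensorRelZ a x s : tensor_rel (gen (a *: x) s - gen x (phi a * s)).

Definition tensor_pred : {pred F} := fun u => `[< tensor_rel u >].

Lemma tensor_predP u : reflect (tensor_rel u) (u \in tensor_pred).
Proof. exact: asboolP. Qed.

Lemma tensor_pred_closed : zmod_closed tensor_pred.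
Proof.
split; first by apply/tensor_predP/TensorRel0.
by move=> u v /tensor_predP ru /tensor_predP rv; apply/tensor_predP/TensorRelB.
Qed.
HB.instance Definition _ := GRing.isZmodClosed.Build F tensor_pred
  tensor_pred_closed.

Definition tensor : Type := Quotient.quot tensor_pred.
HB.instance Definition _ := GRing.Zmodule.on tensor.

Definition tensor_pi : F -> tensor := \pi_(Quotient.quot tensor_pred).
HB.instance Definition _ := GRing.Additive.on tensor_pi.

Lemma tensor_pi_eq u v : tensor_rel (u - v) -> tensor_pi u = tensor_pi v.
Proof.
by move=> ruv; apply/eqP; rewrite -Quotient.idealrBE; apply/tensor_predP.
Qed.

Lemma tensor_pi_rel u v : tensor_pi u = tensor_pi v -> tensor_rel (u - v).
Proof.
by move=> uv; apply/tensor_predP; rewrite Quotient.idealrBE; apply/eqP.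
Qed.

Lemma tensor_repr (q : tensor) : tensor_pi (repr q) = q.
Proof. exact: reprK. Qed.

Definition pure_tensor (x : L) (s : S) : tensor := tensor_pi (gen x s).

End Tensor.

Section FreegMap.
Variables (K K' : choiceType) (f : K -> K').

Definition freeg_map (u : {freeg K / int}) : {freeg K' / int} :=
  fglift (fun x => << f x >> : {freeg K' / int}) u.

Lemma freeg_map_is_additive : zmod_morphism freeg_map.
Proof. exact: lift_is_additive. Qed.
HB.instance Definition _ :=
  GRing.isZmodMorphism.Build _ _ freeg_map freeg_map_is_additive.

Lemma freeg_map0 : freeg_map 0 = 0.
Proof. exact: raddf0. Qed.
Lemma freeg_mapB u v : freeg_map (u - v) = freeg_map u - freeg_map v.
Proof. exact: raddfB. Qed.
Lemma freeg_mapD u v : freeg_map (u + v) = freeg_map u + freeg_map v.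
Proof. exact: raddfD. Qed.
Lemma freeg_mapU x : freeg_map << x >> = << f x >>.
Proof. by rewrite /freeg_map liftU scale1r. Qed.

Lemma freeg_additive_ext (V : zmodType) (g h : {additive {freeg K / int} -> V}) :
  (forall x, g << x >> = h << x >>) -> g =1 h.
Proof.
move=> gh u; rewrite -(freeg_sumE u) !raddf_sum; apply: eq_bigr => x _ /=.
by rewrite -[coeff x u]intz -freegU_mulz !raddfMz gh.
Qed.
End FreegMap.

Section TensorMap.
Variables (A S : comNzRingType) (phi : {rmorphism A -> S}) (L L' : lmodType A).
Variable f : L * S -> L' * S.
Hypothesis f_rel : forall u, tensor_rel phi u -> tensor_rel phi (freeg_map f u).

Definition tensor_lift (q : tensor phi L) : tensor phi L' :=
  tensor_pi phi (freeg_map f (repr q)).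

Lemma tensor_lift_pi u :
  tensor_lift (tensor_pi phi u) = tensor_pi phi (freeg_map f u).
Proof.
apply: tensor_pi_eq; rewrite -raddfB.
by apply/f_rel/tensor_pi_rel; rewrite tensor_repr.
Qed.

Lemma tensor_lift_is_additive : zmod_morphism tensor_lift.
Proof.
move=> p q; rewrite -(tensor_repr p) -(tensor_repr q).
by rewrite -raddfB !tensor_lift_pi !raddfB.
Qed.

Lemma tensor_lift_pure x s :
  tensor_lift (pure_tensor phi x s) =
  pure_tensor phi (f (x, s)).1 (f (x, s)).2.
Proof. by rewrite tensor_lift_pi freeg_mapU; case: f. Qed.

End TensorMap.

Lemma tensor_additive_ext (A S : comNzRingType) (phi : {rmorphism A -> S})
    (L : lmodType A) (V : zmodType) (g h : tensor phi L -> V) :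
  zmod_morphism g -> zmod_morphism h ->
  (forall x s, g (pure_tensor phi x s) = h (pure_tensor phi x s)) -> g =1 h.
Proof.
move=> gB hB gh q; rewrite -(tensor_repr q); move: (repr q) => u.
have g'B : zmod_morphism (g \o tensor_pi phi (L := L)).
  by move=> p p'; rewrite /= raddfB gB.
have h'B : zmod_morphism (h \o tensor_pi phi (L := L)).
  by move=> p p'; rewrite /= raddfB hB.
pose Ag := GRing.isZmodMorphism.Build _ _ _ g'B.
pose Ah := GRing.isZmodMorphism.Build _ _ _ h'B.
pose g' : {additive _ -> _} := HB.pack (g \o tensor_pi phi (L := L)) Ag.
pose h' : {additive _ -> _} := HB.pack (h \o tensor_pi phi (L := L)) Ah.
apply: (@freeg_additive_ext _ _ g' h') => -[x s]; exact: gh.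
Qed.

Section TensorModule.
Variables (A S : comNzRingType) (phi : {rmorphism A -> S}) (L : lmodType A).
Local Notation T := (tensor phi L).
Local Notation "x (x) s" := (pure_tensor phi x s) (at level 40).

Lemma pure_tensorDl x y s : ((x + y) (x) s = x (x) s + y (x) s :> T).
Proof.
rewrite /pure_tensor -raddfD; apply/tensor_pi_eq/TensorRelDl.
Qed.

Lemma pure_tensorDr x s t : (x (x) (s + t) = x (x) s + x (x) t :> T).
Proof.
rewrite /pure_tensor -raddfD; apply/tensor_pi_eq/TensorRelDr.
Qed.

Lemma pure_tensorZ a x s : ((a *: x) (x) s = x (x) (phi a * s) :> T).
Proof.
apply/tensor_pi_eq/TensorRelZ.
Qed.

Lemma scale_rel (r : S) (u : {freeg (L * S)%type / int}) :
  tensor_rel phi u -> tensor_rel phi (freeg_map (fun p => (p.1, r * p.2)) u).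
Proof.
elim=> [|? ? _ ? _ ?|x y s|x s t|a x s];
  rewrite ?freeg_map0 ?freeg_mapB ?freeg_mapD ?freeg_mapU /= ?mulrDr ?[r * (_ * _)]mulrCA.
- exact: TensorRel0.
- exact: TensorRelB.
- exact: TensorRelDl.
- exact: TensorRelDr.
- exact: TensorRelZ.
Qed.

Definition tensor_scale (r : S) : T -> T :=
  tensor_lift (fun p => (p.1, r * p.2)).

Lemma tensor_scale_is_additive r : zmod_morphism (tensor_scale r).
Proof. exact/tensor_lift_is_additive/scale_rel. Qed.

Lemma tensor_scale_pure r x s : tensor_scale r (x (x) s) = x (x) (r * s).
Proof. exact/tensor_lift_pure/scale_rel. Qed.

Lemma tensor_scaleA r t q :
  tensor_scale r (tensor_scale t q) = tensor_scale (r * t) q.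
Proof.
apply: (tensor_additive_ext (g := fun q => tensor_scale r (tensor_scale t q))).
- by move=> p p'; rewrite !tensor_scale_is_additive.
- exact: tensor_scale_is_additive.
- by move=> x s; rewrite !tensor_scale_pure mulrA.
Qed.
Lemma tensor_scale1 : left_id 1 tensor_scale.
Proof.
apply: (tensor_additive_ext (g := tensor_scale 1) (h := id)).
- exact: tensor_scale_is_additive.
- by [].
- by move=> x s; rewrite tensor_scale_pure mul1r.
Qed.
Lemma tensor_scaleDr : right_distributive tensor_scale +%R.
Proof.
move=> r p q.
have B := tensor_scale_is_additive r.
have sN t : tensor_scale r (- t) = - tensor_scale r t.
  have s0 : tensor_scale r 0 = 0 by have := B 0 0; rewrite !subrr.
  by have := B 0 t; rewrite s0 !sub0r.
by rewrite -[q in LHS]opprK B sN opprK.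
Qed.
Lemma tensor_scaleDl q : {morph tensor_scale^~ q : r t / r + t}.
Proof.
move=> r t; apply: (tensor_additive_ext (g := tensor_scale (r + t))
  (h := fun q => tensor_scale r q + tensor_scale t q)).
- exact: tensor_scale_is_additive.
- by move=> p p'; rewrite !tensor_scale_is_additive addrACA opprD.
- by move=> x s; rewrite !tensor_scale_pure mulrDl pure_tensorDr.
Qed.

HB.instance Definition _ := GRing.Zmodule_isLmodule.Build S T
  tensor_scaleA tensor_scale1 tensor_scaleDr tensor_scaleDl.

Lemma scale_pure_tensor r x s : r *: (x (x) s : T) = x (x) (r * s).
Proof. exact: tensor_scale_pure. Qed.

End TensorModule.

Section TensorFunctor.
Variables (A S : comNzRingType) (phi : {rmorphism A -> S}) (L L' : lmodType A).
Variable f : {linear L -> L'}.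

Lemma map_rel (u : {freeg (L * S)%type / int}) :
  tensor_rel phi u -> tensor_rel phi (freeg_map (fun p => (f p.1, p.2)) u).
Proof.
elim=> [|? ? _ ? _ ?|x y s|x s t|a x s];
  rewrite ?freeg_map0 ?freeg_mapB ?freeg_mapD ?freeg_mapU /=
    ?[f (_ + _)]linearD ?[f (_ *: _)]linearZ.
- exact: TensorRel0.
- exact: TensorRelB.
- exact: TensorRelDl.
- exact: TensorRelDr.
- exact: TensorRelZ.
Qed.

Definition tensor_map : tensor phi L -> tensor phi L' :=
  tensor_lift (fun p => (f p.1, p.2)).

Lemma tensor_map_is_additive : zmod_morphism tensor_map.
Proof. exact/tensor_lift_is_additive/map_rel. Qed.
HB.instance Definition _ :=
  GRing.isZmodMorphism.Build _ _ tensor_map tensor_map_is_additive.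

Lemma tensor_map_pure x s :
  tensor_map (pure_tensor phi x s) = pure_tensor phi (f x) s.
Proof. exact/tensor_lift_pure/map_rel. Qed.

Lemma tensor_map_is_scalable : scalable tensor_map.
Proof.
move=> r; apply: (tensor_additive_ext (g := fun q => tensor_map (r *: q))
  (h := fun q => r *: tensor_map q)).
- by move=> p q; rewrite scalerBr raddfB.
- by move=> p q; rewrite raddfB scalerBr.
- by move=> x s; rewrite scale_pure_tensor !tensor_map_pure scale_pure_tensor.
Qed.
HB.instance Definition _ :=
  GRing.isScalable.Build S _ _ *:%R tensor_map tensor_map_is_scalable.

End TensorFunctor.
Arguments tensor_map {A S} phi {L L'} f _.

Definition is_basis (A : nzRingType) (M : lmodType A) (B : M -> Prop) : Prop :=
  (forall s : seq M, uniq s -> (forall x, x \in s -> B x) ->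
     forall c : M -> A, \sum_(x <- s) c x *: x = 0 ->
     forall x, x \in s -> c x = 0) /\
  (forall y, exists (s : seq M) (c : M -> A),
     (forall x, x \in s -> B x) /\ y = \sum_(x <- s) c x *: x).

Definition free_module (A : nzRingType) (M : lmodType A) : Prop :=
  exists B : M -> Prop, is_basis B.

Definition fg_module (A : nzRingType) (M : lmodType A) : Prop :=
  exists s : seq M, forall x, exists c : 'I_(size s) -> A,
    x = \sum_(i < size s) c i *: s`_i.

Record complex (A : nzRingType) := Complex {
  cx_obj :> int -> lmodType A;
  cx_d : forall n : int, {linear cx_obj (n + 1) -> cx_obj n};
  cx_dd : forall (n : int) (x : cx_obj (n + 1 + 1)), cx_d n (cx_d (n + 1) x) = 0
}.

Definition complex_iso (A : nzRingType) (F G : complex A) : Prop :=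
  exists h : forall n, {linear F n -> G n},
    (forall n, bijective (h n)) /\
    (forall n (x : F (n + 1)), h n (cx_d F n x) = cx_d G n (h (n + 1) x)).

Definition free_complex (A : nzRingType) (F : complex A) : Prop :=
  forall n, free_module (F n).

Section TensorComplex.
Variables (A S : comNzRingType) (phi : {rmorphism A -> S}) (L : complex A).

Lemma tensor_dd n (q : tensor phi (L (n + 1 + 1))) :
  tensor_map phi (cx_d L n) (tensor_map phi (cx_d L (n + 1)) q) = 0.
Proof.
apply: (tensor_additive_ext
  (g := fun q => tensor_map phi (cx_d L n) (tensor_map phi (cx_d L (n + 1)) q))
  (h := fun=> 0)) q.
- by move=> p q; rewrite !raddfB.
- by move=> p q; rewrite subr0.
- move=> x s; rewrite !tensor_map_pure cx_dd.
  by rewrite -(scale0r 0) pure_tensorZ rmorph0 mul0r -(mul0r 0)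
    -scale_pure_tensor scale0r.
Qed.

Definition tensor_complex : complex S :=
  @Complex S (fun n => tensor phi (L n)) (fun n => tensor_map phi (cx_d L n))
    tensor_dd.

End TensorComplex.

Definition complex_liftable (A S : comNzRingType) (phi : {rmorphism A -> S})
    (F : complex S) : Prop :=
  exists L : complex A, free_complex L /\ complex_iso (tensor_complex phi L) F.

Definition free_resolution (A : nzRingType) (F : complex A) (M : lmodType A) :=
  [/\ free_complex F,
      (forall n : int, (n < 0)%R -> forall x : F n, x = 0),
      (forall n : int, (0 <= n)%R -> forall x : F (n + 1),
         cx_d F n x = 0 <-> exists y, x = cx_d F (n + 1) y) &
      exists eps : {linear F 0 -> M},
        (forall m, exists x, eps x = m) /\
        (forall x, eps x = 0 <-> exists y, x = cx_d F 0 y)].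

Definition module_liftable (A S : comNzRingType) (phi : {rmorphism A -> S})
    (M : lmodType S) : Prop :=
  exists F : complex S, free_resolution F M /\ complex_liftable phi F.

Section QuotAlgebra.
Variables (k : fieldType) (R : comAlgType k) (I : idealr R).
Local Notation Q := {ideal_quot I}.

Definition quot_alg_scale (l : k) (q : Q) : Q := \pi_Q (l%:A) * q.

Lemma quot_alg_scaleA l l' q :
  quot_alg_scale l (quot_alg_scale l' q) = quot_alg_scale (l * l') q.
Proof.
by rewrite /quot_alg_scale mulrA -rmorphM -scalerAl mul1r scalerA.
Qed.
Lemma quot_alg_scale1 : left_id 1 quot_alg_scale.
Proof. by move=> q; rewrite /quot_alg_scale scale1r rmorph1 mul1r. Qed.
Lemma quot_alg_scaleDr : right_distributive quot_alg_scale +%R.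
Proof. by move=> l p q; rewrite /quot_alg_scale mulrDr. Qed.
Lemma quot_alg_scaleDl q : {morph quot_alg_scale^~ q : l l' / l + l'}.
Proof. by move=> l l'; rewrite /quot_alg_scale scalerDl rmorphD mulrDl. Qed.
HB.instance Definition _ := GRing.Zmodule_isLmodule.Build k Q
  quot_alg_scaleA quot_alg_scale1 quot_alg_scaleDr quot_alg_scaleDl.

Lemma quot_alg_scaleAl (l : k) (p q : Q) : l *: (p * q) = (l *: p) * q.
Proof. exact: mulrA. Qed.
HB.instance Definition _ := GRing.Lmodule_isLalgebra.Build k Q quot_alg_scaleAl.
HB.instance Definition _ := GRing.Lalgebra_isComAlgebra.Build k Q.

Lemma pi_is_scalable : scalable (\pi_Q : R -> Q).
Proof. by move=> l x; rewrite -mulr_algl rmorphM. Qed.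
HB.instance Definition _ := GRing.isScalable.Build k R Q *:%R \pi_Q
  pi_is_scalable.

End QuotAlgebra.

Record kalg (k : fieldType) := KAlg {
  kalg_sort :> comAlgType k;
  kmax : idealr kalg_sort;
  kmax_maximal : maximal_ideal kmax;
  kmax_residue : bijective (fun l : k => \pi_{ideal_quot kmax} (l%:A))
}.
Arguments kmax {k} _.

Section MkKalg.
Variables (k : fieldType) (R : comAlgType k) (m : idealr R).
Hypothesis mP : forall x, exists l : k, x - l%:A \in m.

Lemma mk_maximal : maximal_ideal m.
Proof.
move=> J mJ x xJ; have [l xl] := mP x.
have [l0|l0] := eqVneq l 0; first by move: xl; rewrite l0 scale0r subr0.
have lJ : l%:A \in J.
  by rewrite -[l%:A](subKr x) rpredB // mJ.
have := idealMr (l^-1%:A) lJ.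
by rewrite -scalerAl mul1r scalerA mulVf // scale1r idealr1.
Qed.

Lemma mk_residue : bijective (fun l : k => \pi_{ideal_quot m} (l%:A)).
Proof.
have inj : injective (fun l : k => \pi_{ideal_quot m} (l%:A)).
  move=> l l' /eqP; rewrite -Quotient.idealrBE -scalerBl => lm.
  apply/eqP; rewrite -subr_eq0; apply/negP => /negP ll.
  have := idealMr ((l - l')^-1%:A) lm.
  by rewrite -scalerAl mul1r scalerA mulVf // scale1r idealr1.
have ex (q : {ideal_quot m}) : exists l : k, \pi_{ideal_quot m} (l%:A) == q.
  elim/quotW: q => x; have [l xl] := mP x; exists l.
  by rewrite eq_sym -Quotient.idealrBE.
exists (fun q => xchoose (ex q)).
- by move=> l; apply: inj; apply/eqP/(xchooseP (ex _)).
- by move=> q; apply/eqP/(xchooseP (ex q)).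
Qed.

Definition mk_kalg : kalg k := KAlg mk_maximal mk_residue.
End MkKalg.

Lemma kalg_residueP (k : fieldType) (R : kalg k) (x : R) :
  exists l : k, x - l%:A \in kmax R.
Proof.
have [g _ gK] := kmax_residue R; exists (g (\pi x)).
by rewrite Quotient.idealrBE; apply/eqP; rewrite gK.
Qed.

Record kalg_hom (k : fieldType) (R S : kalg k) := KAlgHom {
  khom_fun :> {lrmorphism R -> S};
  khom_max : forall x, x \in kmax R -> khom_fun x \in kmax S
}.

Definition kalg_iso (k : fieldType) (R S : kalg k) : Prop :=
  exists (f : kalg_hom R S) (g : kalg_hom S R), cancel f g /\ cancel g f.

Definition is_section (k : fieldType) (R S : kalg k)
    (f : kalg_hom R S) (g : kalg_hom S R) : Prop :=
  [/\ injective f, (forall x, exists y, g y = x) & cancel f g].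

Definition local_kalg (k : fieldType) (R : kalg k) : Prop :=
  forall J : idealr R, maximal_ideal J -> J =i kmax R.

Definition residue_module (k : fieldType) (R : kalg k) : lmodType R :=
  restr \pi_{ideal_quot (kmax R)} ({ideal_quot (kmax R)}^o).

Section BaseKalg.
Variable k : fieldType.

Definition zero_ideal : {pred k^o} := pred1 0.
Lemma zero_ideal_closed : idealr_closed zero_ideal.
Proof.
split; rewrite ?inE ?eqxx ?oner_eq0 // => a x y.
by rewrite !inE => /eqP-> /eqP->; rewrite mulr0 addr0.
Qed.
HB.instance Definition _ := isIdealr.Build k^o zero_ideal zero_ideal_closed.

Lemma base_residueP (x : k^o) : exists l : k, x - l%:A \in zero_ideal.
Proof. by exists x; rewrite [_%:A]mulr1 subrr inE. Qed.

Definition base_kalg : kalg k := mk_kalg base_residueP.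
End BaseKalg.

Section QuotKalg.
Variables (k : fieldType) (R : kalg k) (I : idealr R).
Hypothesis sIm : {subset I <= kmax R}.
Local Notation Q := {ideal_quot I}.

Definition quot_max : {pred Q} :=
  fun q => `[< exists2 x, x \in kmax R & q = \pi x >].

Lemma quot_maxE x : (\pi_Q x \in quot_max) = (x \in kmax R).
Proof.
apply/asboolP/idP => [[y ym /eqP]|xm]; last by exists x.
by rewrite -Quotient.idealrBE => /sIm xy; rewrite -(subrK y x) rpredD.
Qed.

Lemma quot_max_closed : idealr_closed quot_max.
Proof.
split.
- by rewrite -(rmorph0 \pi_Q) quot_maxE rpred0.
- by rewrite -(rmorph1 \pi_Q) quot_maxE idealr1.
move=> a u v; elim/quotW: a => a; elim/quotW: u => u; elim/quotW: v => v.
by rewrite -rmorphM -rmorphD !quot_maxE => um vm; rewrite rpredD ?idealMr.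
Qed.
HB.instance Definition _ := isIdealr.Build Q quot_max quot_max_closed.

Lemma quot_residueP (q : Q) : exists l : k, q - l%:A \in quot_max.
Proof.
elim/quotW: q => x; have [l xl] := kalg_residueP x; exists l.
by rewrite -(rmorph1 \pi_Q) -linearZ -rmorphB quot_maxE.
Qed.

Definition quot_kalg : kalg k := mk_kalg quot_residueP.

Lemma quot_pi_max x : x \in kmax R -> \pi_Q x \in quot_max.
Proof. by rewrite quot_maxE. Qed.

Definition quot_pi : kalg_hom R quot_kalg :=
  @KAlgHom k R quot_kalg \pi_Q quot_pi_max.

End QuotKalg.

Section TrivialExtension.
Variables (k : fieldType) (B : comAlgType k) (M : lmodType B).

Definition trivext : Type := (B * M)%type.
HB.instance Definition _ := GRing.Zmodule.on trivext.

Definition trivext_one : trivext := (1, 0).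
Definition trivext_mul (x y : trivext) : trivext :=
  (x.1 * y.1, x.1 *: y.2 + y.1 *: x.2).

Lemma trivext_mulA : associative trivext_mul.
Proof.
move=> [a x] [b y] [c z]; rewrite /trivext_mul /= mulrA; congr (_, _).
by rewrite !scalerDr !scalerA addrA ![c * _]mulrC.
Qed.
Lemma trivext_mulC : commutative trivext_mul.
Proof. by move=> [a x] [b y]; rewrite /trivext_mul /= mulrC addrC. Qed.
Lemma trivext_mul1 : left_id trivext_one trivext_mul.
Proof. by move=> [a x]; rewrite /trivext_mul /= mul1r scale1r scaler0 addr0. Qed.
Lemma trivext_mulDl : left_distributive trivext_mul +%R.
Proof.
move=> [a x] [b y] [c z]; rewrite /trivext_mul /=; congr (_, _).
  by rewrite mulrDl.
by rewrite scalerDl scalerDr addrACA.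
Qed.
Lemma trivext_1_neq0 : trivext_one != 0.
Proof. by apply/eqP => -[/eqP]; rewrite oner_eq0. Qed.
HB.instance Definition _ := GRing.Zmodule_isComNzRing.Build trivext
  trivext_mulA trivext_mulC trivext_mul1 trivext_mulDl trivext_1_neq0.

Lemma trivext_mul_fst (x y : trivext) : (x * y).1 = x.1 * y.1.
Proof. by []. Qed.
Lemma trivext_mul_snd (x y : trivext) : (x * y).2 = x.1 *: y.2 + y.1 *: x.2.
Proof. by []. Qed.

Definition trivext_scale (l : k) (x : trivext) : trivext :=
  (l *: x.1, l%:A *: x.2).
Lemma trivext_scaleA l l' x :
  trivext_scale l (trivext_scale l' x) = trivext_scale (l * l') x.
Proof.
by rewrite /trivext_scale /= !scalerA -scalerAl mul1r scalerA.
Qed.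
Lemma trivext_scale1 : left_id 1 trivext_scale.
Proof. by move=> [a x]; rewrite /trivext_scale /= !scale1r. Qed.
Lemma trivext_scaleDr : right_distributive trivext_scale +%R.
Proof. by move=> l [a x] [b y]; rewrite /trivext_scale /= !scalerDr. Qed.
Lemma trivext_scaleDl x : {morph trivext_scale^~ x : l l' / l + l'}.
Proof. by move=> l l'; rewrite /trivext_scale /= !scalerDl. Qed.
HB.instance Definition _ := GRing.Zmodule_isLmodule.Build k trivext
  trivext_scaleA trivext_scale1 trivext_scaleDr trivext_scaleDl.

Lemma trivext_scaleAl (l : k) (x y : trivext) : l *: (x * y) = (l *: x) * y.
Proof.
case: x y => [a x] [b y]; congr (_, _) => /=; first by rewrite scalerAl.
by rewrite scalerDr !scalerA -!scalerAl !mul1r -scalerAr mulr1.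
Qed.
HB.instance Definition _ :=
  GRing.Lmodule_isLalgebra.Build k trivext trivext_scaleAl.
HB.instance Definition _ := GRing.Lalgebra_isComAlgebra.Build k trivext.

End TrivialExtension.

Section TrivialExtensionKalg.
Variables (k : fieldType) (B : kalg k) (M : lmodType B).
Local Notation T := (trivext M).

Definition trivext_max : {pred T} := fun x => x.1 \in kmax B.

Lemma trivext_max_closed : idealr_closed trivext_max.
Proof.
split; rewrite /in_mem /=; first exact: rpred0.
  by apply/negP; rewrite /trivext_max idealr1.
by move=> a u v um vm; rewrite /trivext_max /= rpredD ?idealMr.
Qed.
HB.instance Definition _ := isIdealr.Build T trivext_max trivext_max_closed.

Lemma trivext_residueP (x : T) : exists l : k, x - l%:A \in trivext_max.
Proof. by have [l xl] := kalg_residueP x.1; exists l. Qed.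

Definition trivext_kalg : kalg k := mk_kalg trivext_residueP.
End TrivialExtensionKalg.

(* Unitality of the action is the case l = 1 of [sf_actk].                    *)
Record sf_action (k : fieldType) (B S : kalg k) := SFAction {
  sf_act :> B -> ideal_of (kmax S) -> ideal_of (kmax S);
  sf_actDl : forall b b' y, sf_act (b + b') y = sf_act b y + sf_act b' y;
  sf_actDr : forall b y y', sf_act b (y + y') = sf_act b y + sf_act b y';
  sf_actM : forall b b' y, sf_act (b * b') y = sf_act b (sf_act b' y);
  sf_actk : forall (l : k) y, sf_act (l%:A) y = (l%:A : S) *: y;
  sf_actS : forall b (s : S) y, sf_act b (s *: y) = s *: sf_act b y
}.

Section SemiFiberProduct.
Variables (k : fieldType) (B S : kalg k) (act : sf_action B S).

Definition sfprod : Type := (B * ideal_of (kmax S))%type.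
HB.instance Definition _ := GRing.Zmodule.on sfprod.

Definition sfprod_one : sfprod := (1, 0).
(* The product yy' of elements of m_S is written [val y *: y'].               *)
Definition sfprod_mul (x y : sfprod) : sfprod :=
  (x.1 * y.1, act x.1 y.2 + act y.1 x.2 + val x.2 *: y.2).

Lemma sf_act0 b : act b 0 = 0.
Proof. by apply: (addrI (act b 0)); rewrite -sf_actDr !addr0. Qed.
Lemma sf_act1 y : act 1 y = y.
Proof. by have := sf_actk act 1 y; rewrite !scale1r. Qed.
Lemma sf_actZ (l : k) b y : act (l *: b) y = (l%:A : S) *: act b y.
Proof. by rewrite -[l *: b]mulr_algl sf_actM sf_actk. Qed.
Lemma sf_actC b b' y : act b (act b' y) = act b' (act b y).
Proof. by rewrite -!sf_actM mulrC. Qed.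
Lemma sf_mulC (y y' : ideal_of (kmax S)) : val y *: y' = val y' *: y.
Proof. by apply: val_inj; rewrite !val_idealZ mulrC. Qed.
Lemma sf_act_val b y y' : sval (act b y) *: y' = act b (sval y *: y').
Proof. by rewrite sf_mulC -sf_actS sf_mulC. Qed.

Lemma sfprod_mulC : commutative sfprod_mul.
Proof.
by move=> [a x] [b y]; rewrite /sfprod_mul /= mulrC sf_mulC [act a y + _]addrC.
Qed.
Lemma sfprod_mulA : associative sfprod_mul.
Proof.
move=> [a x] [b y] [c z]; rewrite /sfprod_mul /= mulrA; congr (_, _).
rewrite !sf_actDr !scalerDr !scalerDl !sf_actM !sf_act_val !sf_actS scalerA.
rewrite [act c (act a y)]sf_actC [act c (act b x)]sf_actC.
rewrite !addrA [LHS](ACl (1*2*4*6*3*5*7)) //.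
Qed.
Lemma sfprod_mul1 : left_id sfprod_one sfprod_mul.
Proof.
move=> [a x]; rewrite /sfprod_mul /= mul1r sf_act0 sf_act1 scale0r !addr0.
by [].
Qed.
Lemma sfprod_mulDl : left_distributive sfprod_mul +%R.
Proof.
move=> [a x] [b y] [c z]; rewrite /sfprod_mul /=; congr (_, _).
  exact: mulrDl.
rewrite sf_actDl sf_actDr scalerDl !addrA.
by rewrite [LHS](ACl (1*3*5*2*4*6)).
Qed.
Lemma sfprod_1_neq0 : sfprod_one != 0.
Proof. by apply/eqP => -[/eqP]; rewrite oner_eq0. Qed.
HB.instance Definition _ := GRing.Zmodule_isComNzRing.Build sfprod
  sfprod_mulA sfprod_mulC sfprod_mul1 sfprod_mulDl sfprod_1_neq0.

Definition sfprod_scale (l : k) (x : sfprod) : sfprod :=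
  (l *: x.1, (l%:A : S) *: x.2).
Lemma sfprod_scaleA l l' x :
  sfprod_scale l (sfprod_scale l' x) = sfprod_scale (l * l') x.
Proof. by rewrite /sfprod_scale /= !scalerA -scalerAl mul1r scalerA. Qed.
Lemma sfprod_scale1 : left_id 1 sfprod_scale.
Proof. by move=> [a x]; rewrite /sfprod_scale /= !scale1r. Qed.
Lemma sfprod_scaleDr : right_distributive sfprod_scale +%R.
Proof. by move=> l [a x] [b y]; rewrite /sfprod_scale /= !scalerDr. Qed.
Lemma sfprod_scaleDl x : {morph sfprod_scale^~ x : l l' / l + l'}.
Proof. by move=> l l'; rewrite /sfprod_scale /= !scalerDl. Qed.
HB.instance Definition _ := GRing.Zmodule_isLmodule.Build k sfprod
  sfprod_scaleA sfprod_scale1 sfprod_scaleDr sfprod_scaleDl.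

Lemma sfprod_scaleAl (l : k) (x y : sfprod) : l *: (x * y) = (l *: x) * y.
Proof.
case: x y => [a x] [b y]; congr (_, _) => /=; first by rewrite scalerAl.
by rewrite sf_actZ sf_actS !scalerDr scalerA.
Qed.
HB.instance Definition _ :=
  GRing.Lmodule_isLalgebra.Build k sfprod sfprod_scaleAl.
HB.instance Definition _ := GRing.Lalgebra_isComAlgebra.Build k sfprod.

Definition sfprod_max : {pred sfprod} := fun x => x.1 \in kmax B.

Lemma sfprod_max_closed : idealr_closed sfprod_max.
Proof.
split; rewrite /in_mem /=; first exact: rpred0.
  by apply/negP; rewrite /sfprod_max idealr1.
by move=> a u v um vm; rewrite /sfprod_max /= rpredD ?idealMr.
Qed.
HB.instance Definition _ := isIdealr.Build sfprod sfprod_max sfprod_max_closed.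

Lemma sfprod_residueP (x : sfprod) : exists l : k, x - l%:A \in sfprod_max.
Proof. by have [l xl] := kalg_residueP x.1; exists l. Qed.

Definition sfprod_kalg : kalg k := mk_kalg sfprod_residueP.

End SemiFiberProduct.

(* For a B-module M, the k-algebra k |x M with specified maximal ideal M, and *)
(* the action of B on this ideal given by the module structure.               *)
Section VectorSpaceExtension.
Variables (k : fieldType) (B : kalg k) (M : lmodType B).

Definition ktrivext : kalg k :=
  @trivext_kalg k (base_kalg k) (restr (in_alg B) M).

Local Notation mS := (ideal_of (kmax ktrivext)).

Lemma ktrivext_maxE (x : ktrivext) : (x \in kmax ktrivext) = (x.1 == 0).
Proof. by []. Qed.

Definition ktrivext_in (x : M) : mS :=
  exist _ ((0, x) : ktrivext) (eqxx (0 : k)).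

Definition ktrivext_out (y : mS) : M := (val y).2.

Lemma ktrivext_outD y y' :
  ktrivext_out (y + y') = ktrivext_out y + ktrivext_out y'.
Proof. by []. Qed.

Lemma ktrivext_outZ (s : ktrivext) y :
  ktrivext_out (s *: y) = in_alg B s.1 *: ktrivext_out y.
Proof.
have y0 : (val y).1 = 0 by apply/eqP/(valP y).
rewrite /ktrivext_out val_idealZ trivext_mul_snd y0 scale0r addr0.
exact: restr_scaleE.
Qed.

Lemma ktrivext_outK : cancel ktrivext_out ktrivext_in.
Proof. by case=> [[a x] a0]; apply: val_inj; congr (_, _); apply/esym/eqP. Qed.

Lemma ktrivext_inK : cancel ktrivext_in ktrivext_out.
Proof. by []. Qed.

Definition ktrivext_act (b : B) (y : mS) : mS :=
  ktrivext_in (b *: ktrivext_out y).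

Lemma ktrivext_actDl b b' y :
  ktrivext_act (b + b') y = ktrivext_act b y + ktrivext_act b' y.
Proof.
by apply: val_inj; congr (_, _) => /=; rewrite ?addr0 ?scalerDl.
Qed.
Lemma ktrivext_actDr b y y' :
  ktrivext_act b (y + y') = ktrivext_act b y + ktrivext_act b y'.
Proof.
apply: val_inj; congr (_, _) => /=; first by rewrite addr0.
by rewrite ktrivext_outD scalerDr.
Qed.
Lemma ktrivext_actM b b' y :
  ktrivext_act (b * b') y = ktrivext_act b (ktrivext_act b' y).
Proof. by apply: val_inj; congr (_, _); rewrite -scalerA. Qed.
Lemma ktrivext_actS b (s : ktrivext) y :
  ktrivext_act b (s *: y) = s *: ktrivext_act b y.
Proof.
apply: (can_inj ktrivext_outK).
rewrite ktrivext_outZ !ktrivext_inK ktrivext_outZ !scalerA.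
by congr (_ *: _); exact: mulrC.
Qed.
Lemma ktrivext_actk (l : k) y :
  ktrivext_act (l%:A) y = (l%:A : ktrivext) *: y.
Proof.
apply: (can_inj ktrivext_outK); rewrite ktrivext_outZ ktrivext_inK.
by congr (_ *: _); exact: (congr1 (in_alg B) (esym (mulr1 l))).
Qed.

Definition ktrivext_action : sf_action B ktrivext :=
  SFAction ktrivext_actDl ktrivext_actDr ktrivext_actM ktrivext_actk
    ktrivext_actS.

End VectorSpaceExtension.

Section SquareZeroIdeal.
Variables (A : comNzRingType) (m I : idealr A).
Hypothesis sIm : {subset I <= m}.
Hypothesis mI0 : forall x y, x \in m -> y \in I -> x * y = 0.

Lemma ideal_killed : killed_by I (ideal_of I).
Proof.
by move=> a x aI; apply: val_inj; rewrite val_idealZ mI0 ?(valP x) ?sIm.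
Qed.

Definition quot_ideal : lmodType {ideal_quot I} := quot_module ideal_killed.

End SquareZeroIdeal.

(* Main.v *)
Require Import Defs.
From HB Require Import structures.
From mathcomp Require Import all_boot all_order all_algebra ring.
From mathcomp Require Import generic_quotient ring_quotient freeg boolp.

Set Implicit Arguments.
Unset Strict Implicit.
Unset Printing Implicit Defensive.

Import GRing.Theory.
Local Open Scope ring_scope.
Local Open Scope quotient_scope.

(** Write m for the maximal ideal of R and pi : R -> R/I for the projection.
    All four conditions turn out to be equivalent to the single equation
    I /\ m^2 = 0, and the proof is organised around it.

    Liftability of k gives I /\ m^2 = 0 ([square_cap_ideal0_of_liftable]).  Let
    L lift a free resolution F of k, and let x0 in L_0 map to 1 in k.  If p is
    in m then p x0 maps to 0 in k, so by exactness of F it is a boundary up to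
    an element of I L_0; multiplying by q in m kills that error because
    m I = 0.  Hence every x in m^2 multiplies x0 into the boundaries:
    x x0 = d y.  If x also lies in I, then y becomes a cycle of F, so, F being
    exact, y is a boundary up to an element of I L_1, and d y is a combination
    of boundaries with coefficients in I.  A linear form on the free module
    L_0 which lifts the augmentation sends boundaries into m, hence d y to
    m I = 0, whereas it sends x x0 to x.  So x = 0.

    An isomorphism of R with the trivial extension T of R/I by I gives
    I /\ m^2 = 0 as well ([square_cap_ideal0_of_iso]).  That isomorphism need
    not be compatible with pi, so one counts dimensions of cotangent spaces,
    which are finite since R is noetherian.  The space m/m^2 has dimension
    dim m/(m^2 + I) + dim I/(I /\ m^2), while the cotangent space of T has
    dimension dim m/(m^2 + I) + dim I.

    If I /\ m^2 = 0, pick elements b_j of m forming a basis of m/(m^2 + I).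
    Then N = m^2 + <b_j> is a complement of I in m, and k + N is a subalgebra
    of R mapped isomorphically onto R/I: its inverse is a section of pi
    ([section_of_square_cap_ideal0]).

    A section f of pi gives the decomposition (b, y) |-> f b + y of R, and it
    lifts every module: base change along f of a free resolution over R/I is
    a complex of free R-modules reducing to that resolution. *)

(** * Free modules on a set of generators *)

Section FreeLift.
Variables (A : nzRingType) (K : choiceType) (M : lmodType A) (g : K -> M).

Definition free_lift (u : {freeg K / A}) : M := fglift g u.

Lemma scale_freegU (a b : A) (x : K) :
  a *: << b *g x >> = << a * b *g x >> :> {freeg K / A}.
Proof. by apply/eqP/freeg_eqP => y; rewrite coeffZ !coeffU mulrA. Qed.

Lemma freegUE (a : A) (x : K) : << a *g x >> = a *: << x >> :> {freeg K / A}.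
Proof. by rewrite scale_freegU mulr1. Qed.

Lemma free_lift_is_zmod_morphism : zmod_morphism free_lift.
Proof. exact: lift_is_additive. Qed.
HB.instance Definition _ :=
  GRing.isZmodMorphism.Build {freeg K / A} M free_lift free_lift_is_zmod_morphism.

Lemma free_lift_is_scalable : scalable free_lift.
Proof.
move=> a u; rewrite -(freeg_sumE u) scaler_sumr !raddf_sum.
apply: eq_bigr => x _ /=; rewrite /free_lift.
by rewrite scale_freegU !liftU scalerA.
Qed.
HB.instance Definition _ :=
  GRing.isScalable.Build A {freeg K / A} M *:%R free_lift free_lift_is_scalable.

Lemma free_liftU x : free_lift << x >> = g x.
Proof. by rewrite /free_lift liftU scale1r. Qed.

End FreeLift.

(** The maps are only required to be additive, so as to compare maps which are
    semilinear along a ring homomorphism. *)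
Lemma freeg_ext (A : nzRingType) (K : choiceType) (V : zmodType)
    (g h : {freeg K / A} -> V) :
    zmod_morphism g -> zmod_morphism h ->
  (forall a x, g (a *: << x >>) = h (a *: << x >>)) -> g =1 h.
Proof.
move=> gB hB gh u.
pose g' : {additive {freeg K / A} -> V} :=
  HB.pack g (GRing.isZmodMorphism.Build {freeg K / A} V g gB).
pose h' : {additive {freeg K / A} -> V} :=
  HB.pack h (GRing.isZmodMorphism.Build {freeg K / A} V h hB).
rewrite -[LHS]/(g' u) -[RHS]/(h' u) -(freeg_sumE u) !raddf_sum.
by apply: eq_bigr => x _; rewrite freegUE; apply: gh.
Qed.

Lemma free_linear_ext (A : nzRingType) (K : choiceType) (M : lmodType A)
    (g h : {linear {freeg K / A} -> M}) :
  (forall x, g << x >> = h << x >>) -> g =1 h.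
Proof.
by move=> gh; apply: freeg_ext => [||a x]; try exact: raddfB; rewrite !linearZ /= gh.
Qed.

Lemma free_freeg (A : nzRingType) (K : choiceType) :
  free_module ({freeg K / A} : lmodType A).
Proof.
exists (fun u => exists x, u = << x >>); split=> [s us sB c c0 v xs|u].
  have [x xE] := sB _ xs.
  have := congr1 (coeff x) c0; rewrite raddf_sum coeff0 (bigD1_seq _ xs us) /=.
  rewrite {2}xE coeffZ coeffU eqxx !mulr1 big_seq_cond big1 ?addr0 // => y.
  case/andP=> /sB [z ->]; rewrite xE => zx; rewrite coeffZ coeffU mul1r.
  by move: zx; have [->|_] := eqVneq z x; rewrite ?eqxx ?mulr0.
exists [seq << x >> | x <- dom u].
exists (fun v => \sum_(x <- dom u | v == << x >>) coeff x u).
split=> [_ /mapP[x _ ->]|]; first by exists x.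
rewrite big_map -[LHS]freeg_sumE; apply: eq_big_seq => x xu; rewrite freegUE.
congr (_ *: _); rewrite big_mkcond (bigD1_seq x) ?uniq_dom //= eqxx.
rewrite big1 ?addr0 // => y yx; case: eqP => // /(congr1 (coeff x)).
rewrite !coeffU eqxx (negPf yx) mulr1 mulr0 => /eqP.
by rewrite oner_eq0.
Qed.

(** Any basis B presents the module as the free module on the subtype of
    elements of B; working there replaces arbitrary bases by coordinates. *)
Lemma free_module_freeg (A : nzRingType) (L : lmodType A) :
  free_module L ->
  exists (K : choiceType) (h : {linear {freeg K / A} -> L}), bijective h.
Proof.
case=> B [Bfree Bspan]; pose K := {x : L | `[< B x >]}.
pose h : {linear {freeg K / A} -> L} := free_lift (fun x : K => val x).
have h_inj : injective h.
  apply: raddf_inj => u hu0; apply/eqP; rewrite -dom_eq0.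
  case dE: (dom u) => [//|x0 d]; have x0u : x0 \in dom u by rewrite dE mem_head.
  pose c y := if insub y is Some x then coeff (x : K) u else 0.
  have cE (x : K) : c (val x) = coeff x u by rewrite /c valK.
  have := Bfree (map val (dom u)); rewrite (map_inj_uniq val_inj) uniq_dom.
  move=> /(_ isT) /(_ _ c) c0; suff: c (val x0) = 0.
    by rewrite cE => /eqP cx0; move: x0u; rewrite mem_dom cx0.
  apply: c0; last exact: map_f.
    by move=> _ /mapP[x _ ->]; apply/asboolP/(valP x).
  rewrite big_map; transitivity (h u) => //; rewrite -{2}(freeg_sumE u) raddf_sum.
  by apply: eq_bigr => x _ /=; rewrite freegUE linearZ /= free_liftU cE.
have h_surj y : exists u, h u = y.
  have [s [c [sB ->]]] := Bspan y; elim: s sB => [|x s IH] sB.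
    by exists 0; rewrite big_nil raddf0.
  have /IH[u uE] : forall y, y \in s -> B y.
    by move=> z zs; apply: sB; rewrite inE zs orbT.
  have Bx : `[< B x >] by apply/asboolP/sB/mem_head.
  exists (c x *: << (Sub x Bx : K) >> + u).
  by rewrite big_cons linearD linearZ /= free_liftU uE.
exists K, h; exists (fun y => projT1 (cid (h_surj y))) => [u|y].
  by apply: h_inj; case: cid.
by case: cid.
Qed.

(** * Base change to a quotient ring *)

Section TensorBilinear.
Variables (A S : comNzRingType) (phi : {rmorphism A -> S}) (L : lmodType A).

(** The universal property of the tensor product, up to a subgroup P of V: a
    pairing which is balanced modulo P sends tensor relations into P.  With
    P = 0 it yields maps out of the tensor product; with P = IL it computes
    which elements of L die in L/IL. *)
Lemma balanced_lift (V : zmodType) (P : V -> Prop) (beta : L -> S -> V) :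
    P 0 -> (forall u v, P u -> P v -> P (u - v)) ->
    (forall x y s, P (beta (x + y) s - (beta x s + beta y s))) ->
    (forall x s t, P (beta x (s + t) - (beta x s + beta x t))) ->
    (forall a x s, P (beta (a *: x) s - beta x (phi a * s))) ->
  forall u, tensor_rel phi u ->
    P (free_lift (fun p => beta p.1 p.2 : zmodule V) u).
Proof.
move=> P0 PB Dl Dr Z u; set b := fun p => _; elim=> [|v w _ Pv _ Pw|x y s|x s t|a x s].
- by rewrite raddf0.
- by rewrite raddfB; apply: PB.
- by rewrite raddfB raddfD /= !free_liftU; apply: Dl.
- by rewrite raddfB raddfD /= !free_liftU; apply: Dr.
- by rewrite raddfB /= !free_liftU; apply: Z.
Qed.

Lemma pure_tensor0 s : pure_tensor phi (0 : L) s = 0.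
Proof.
by rewrite -(scale0r 0) pure_tensorZ rmorph0 mul0r -(mul0r 0)
  -scale_pure_tensor scale0r.
Qed.

Lemma pure_tensorB x y s :
  pure_tensor phi (x - y : L) s = pure_tensor phi x s - pure_tensor phi y s.
Proof. by apply/eqP; rewrite eq_sym subr_eq -pure_tensorDl subrK. Qed.

Lemma pure_tensorMz x s m :
  pure_tensor phi ((x : L) *~ m) s = pure_tensor phi x s *~ m.
Proof.
pose Ap := GRing.isZmodMorphism.Build _ _ _ (fun x y => pure_tensorB x y s).
pose p : {additive _ -> _} := HB.pack (fun x : L => pure_tensor phi x s) Ap.
exact: (raddfMz p m x).
Qed.

Lemma tensor_linear_ext (N : lmodType S) (g h : {linear tensor phi L -> N}) :
  (forall x, g (pure_tensor phi x 1) = h (pure_tensor phi x 1)) -> g =1 h.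
Proof.
move=> gh; apply: tensor_additive_ext => [||x s]; try exact: raddfB.
by rewrite -[s]mulr1 -scale_pure_tensor !linearZ /= gh.
Qed.

Section Desc.
Variables (N : lmodType S) (f : {linear L -> restr phi N}).

Let beta (p : L * S) : zmodule N := p.2 *: (f p.1 : N).

Definition tensor_desc (q : tensor phi L) : N := free_lift beta (repr q).

Let free_lift_rel u : tensor_rel phi u -> free_lift beta u = 0.
Proof.
apply: (@balanced_lift N (fun v => v = 0) (fun x s => s *: (f x : N))) => //.
- by move=> ? ? -> ->; rewrite subrr.
- by move=> x y s; rewrite raddfD scalerDr subrr.
- by move=> x s t; rewrite scalerDl subrr.
- move=> a x s; have -> : f (a *: x) = phi a *: (f x : N) :> N by rewrite linearZ.
  by rewrite scalerA mulrC subrr.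
Qed.

Let tensor_desc_pi u : tensor_desc (tensor_pi phi u) = free_lift beta u.
Proof.
apply/eqP; rewrite -subr_eq0 -[_ - _](raddfB (free_lift beta)); apply/eqP.
by apply/free_lift_rel/tensor_pi_rel; rewrite tensor_repr.
Qed.

Lemma tensor_desc_is_zmod_morphism : zmod_morphism tensor_desc.
Proof.
move=> p q; rewrite -(tensor_repr p) -(tensor_repr q) -raddfB !tensor_desc_pi.
exact: (raddfB (free_lift beta)).
Qed.
HB.instance Definition _ := GRing.isZmodMorphism.Build (tensor phi L) N
  tensor_desc tensor_desc_is_zmod_morphism.

Lemma tensor_desc_pure x s : tensor_desc (pure_tensor phi x s) = s *: (f x : N).
Proof. by rewrite tensor_desc_pi free_liftU. Qed.

Lemma tensor_desc_is_scalable : scalable tensor_desc.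
Proof.
move=> r; apply: (tensor_additive_ext (g := fun q => tensor_desc (r *: q))
  (h := fun q => r *: tensor_desc q)).
- by move=> p q; rewrite scalerBr raddfB.
- by move=> p q; rewrite raddfB scalerBr.
- by move=> x s; rewrite scale_pure_tensor !tensor_desc_pure scalerA.
Qed.
HB.instance Definition _ := GRing.isScalable.Build S (tensor phi L) N *:%R
  tensor_desc tensor_desc_is_scalable.
End Desc.
End TensorBilinear.

Section TensorQuotient.
Variables (A : comNzRingType) (I : idealr A) (L : lmodType A).
Local Notation pi := (\pi_{ideal_quot I} : {rmorphism A -> {ideal_quot I}}).

(** The submodule IL of L. *)
Inductive ideal_span : L -> Prop :=
  | IdealSpan0 : ideal_span 0
  | IdealSpanD a x y : a \in I -> ideal_span y -> ideal_span (a *: x + y).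

Lemma ideal_spanZ a x : a \in I -> ideal_span (a *: x).
Proof. by move=> aI; rewrite -[_ *: _]addr0; do 2?constructor. Qed.

Lemma ideal_spanD x y : ideal_span x -> ideal_span y -> ideal_span (x + y).
Proof.
by elim=> [|a z t aI _ IH] sy; rewrite ?add0r // -addrA; constructor; auto.
Qed.

Lemma ideal_spanN x : ideal_span x -> ideal_span (- x).
Proof.
elim=> [|a z t aI _ IH]; first by rewrite oppr0; constructor.
by rewrite opprD -scalerN; constructor.
Qed.

Lemma ideal_quot_eq0 a : (\pi_{ideal_quot I} a == 0) = (a \in I).
Proof. by rewrite -(rmorph0 \pi_{ideal_quot I}) -Quotient.idealrBE subr0. Qed.

Lemma tensor_quot_surj (q : tensor pi L) : exists x, q = pure_tensor pi x 1.
Proof.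
rewrite -(tensor_repr q); move: (repr q) => u; rewrite -(freeg_sumE u) raddf_sum.
elim: (dom u) => [|[x s] d [y yE]].
  by exists 0; rewrite big_nil pure_tensor0.
rewrite big_cons yE; exists ((repr s *: x) *~ coeff (x, s) u + y).
rewrite pure_tensorDl -{1}[coeff (x, s) u]intz -freegU_mulz raddfMz.
rewrite pure_tensorMz pure_tensorZ mulr1 /=.
by rewrite reprK.
Qed.

(** Together with its converse [tensor_quot_span], this identifies the tensor
    product of L with A/I with L/IL.  The pairing (y, s) |-> s y, with s lifted
    to A, is balanced modulo IL. *)
Lemma tensor_quot_eq0 x : pure_tensor pi x 1 = 0 -> ideal_span x.
Proof.
move=> x0; have rx : tensor_rel pi << (x, 1) >>.
  by rewrite -[<<_>>]subr0; apply: tensor_pi_rel; rewrite raddf0.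
have sI a b y : a - b \in I -> ideal_span (a *: y - b *: y).
  by rewrite -scalerBl; apply: ideal_spanZ.
have {rx} := @balanced_lift _ _ pi L L ideal_span (fun y s => repr s *: y)
  _ _ _ _ _ _ rx.
rewrite free_liftU /= => sx.
rewrite -(subKr (repr (1 : {ideal_quot I}) *: x) x); apply: ideal_spanD.
  apply: sx => [|u v su sv|y z s|y s t|a y s]; first by constructor.
  - by apply: ideal_spanD => //; apply: ideal_spanN.
  - by rewrite scalerDr subrr; constructor.
  - rewrite -scalerDl; apply: sI.
    by rewrite Quotient.idealrBE reprK raddfD /= !reprK.
  - rewrite scalerA; apply: sI.
    by rewrite Quotient.idealrBE reprK rmorphM /= reprK mulrC.
apply: ideal_spanN; rewrite -[X in _ - X]scale1r; apply: sI.
by rewrite Quotient.idealrBE reprK rmorph1.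
Qed.

Lemma tensor_quot_span x : ideal_span x -> pure_tensor pi x 1 = 0.
Proof.
elim=> [|a y z aI _ IH]; last first.
  rewrite pure_tensorDl IH pure_tensorZ addr0.
  move: aI; rewrite -ideal_quot_eq0 /= => /eqP ->.
  by rewrite -scale_pure_tensor scale0r.
exact: pure_tensor0.
Qed.

End TensorQuotient.

(** * A lift of the residue field forces the ideal to miss the square *)

(** A free module is projective: a functional with values in the quotient
    ring E of A lifts to A, since its values on a basis do. *)
Lemma free_lift_residue (A E : comNzRingType) (rho : {rmorphism A -> E})
    (L : lmodType A) (lambda : L -> E) :
    (forall e, exists a, rho a = e) ->
    zmod_morphism lambda -> (forall a x, lambda (a *: x) = rho a * lambda x) ->
    free_module L ->
  exists Lambda : {linear L -> A^o}, forall x, rho (Lambda x) = lambda x.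
Proof.
move=> rho_surj lambdaB lambdaZ /free_module_freeg[K [h [h' hK h'K]]].
have h'lin : linear h' by apply: can2_linear hK h'K.
pose h'L : {linear L -> {freeg K / A}} := HB.pack h'
  (GRing.isLinear.Build A L {freeg K / A} *:%R h' h'lin).
pose lambdaA : {additive L -> E} := HB.pack lambda
  (GRing.isZmodMorphism.Build L E lambda lambdaB).
pose lift e := projT1 (cid (rho_surj e)).
have liftK e : rho (lift e) = e by rewrite /lift; case: cid.
pose g x : A^o := lift (lambda (h << x >>)).
exists (free_lift g \o h'L) => x /=; rewrite -[in RHS](h'K x); move: (h' x) => u.
rewrite -[RHS]/(lambdaA _) -(freeg_sumE u) !raddf_sum; apply: eq_bigr => y _.
by rewrite freegUE /= !linearZ /= free_liftU rmorphM liftK lambdaZ.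
Qed.

Section SquareOfIdeal.
Variables (A : comNzRingType) (m : idealr A).
Local Notation m2 := (ideal_pow m 2).

Lemma ideal_pow2_ind (P : A -> Prop) :
    P 0 -> (forall a p q x, p \in m -> q \in m -> P x -> P (a * (p * q) + x)) ->
  forall x, m2 x -> P x.
Proof.
move=> P0 PD x; elim=> [//|a f {}x fm _ Px].
by rewrite big_ord_recl big_ord1; apply: PD.
Qed.

Lemma ideal_pow2_add_mul a p q x :
  p \in m -> q \in m -> m2 x -> m2 (a * (p * q) + x).
Proof.
move=> pm qm mx; have -> : p * q = \prod_(i < 2) (if i == ord0 then p else q).
  by rewrite big_ord_recl big_ord1.
by constructor=> // i; case: ifP.
Qed.

Lemma ideal_pow2M p q : p \in m -> q \in m -> m2 (p * q).
Proof.
move=> pm qm; rewrite -[_ * _]addr0 -[_ * _]mul1r.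
by apply: ideal_pow2_add_mul => //; constructor.
Qed.

Lemma ideal_pow2D x y : m2 x -> m2 y -> m2 (x + y).
Proof.
move=> m2x m2y; elim/ideal_pow2_ind: x / m2x => [|a p q x pm qm IH].
  by rewrite add0r.
by rewrite -addrA; apply: ideal_pow2_add_mul.
Qed.

Lemma ideal_pow2Ml a x : m2 x -> m2 (a * x).
Proof.
elim/ideal_pow2_ind: x / => [|b p q x pm qm IH]; first by rewrite mulr0; constructor.
by rewrite mulrDr [a * (b * _)]mulrA; apply: ideal_pow2_add_mul.
Qed.

Lemma ideal_pow2_sub x : m2 x -> x \in m.
Proof.
elim/ideal_pow2_ind: x / => [|a p q x pm qm xm]; first exact: rpred0.
by rewrite rpredD ?idealMr.
Qed.

End SquareOfIdeal.

Section LiftedResidueField.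
Variables (A E : comNzRingType) (m I : idealr A).
Hypothesis mI0 : forall x y, x \in m -> y \in I -> x * y = 0.
Variable rho : {rmorphism A -> E}.
Hypothesis rho_surj : forall e, exists a, rho a = e.
Hypothesis rho_ker : forall a, (rho a == 0) = (a \in m).

Lemma ideal_span_killed (L : lmodType A) q (x : L) :
  q \in m -> ideal_span I x -> q *: x = 0.
Proof.
move=> qm; elim=> [|a y z aI _ IH]; first by rewrite scaler0.
by rewrite scalerDr scalerA mI0 // scale0r IH addr0.
Qed.

Variables (L0 L1 L2 : lmodType A) (d0 : {linear L1 -> L0}) (d1 : {linear L2 -> L1}).
Variable lambda : L0 -> E.
Hypothesis lambdaB : zmod_morphism lambda.
Hypothesis lambdaZ : forall a x, lambda (a *: x) = rho a * lambda x.
Hypothesis freeL0 : free_module L0.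
Hypothesis dd : forall z, d0 (d1 z) = 0.
Hypothesis lambda1 : exists x, lambda x = 1.
Hypothesis lambda_d0 : forall y, lambda (d0 y) = 0.
Hypothesis exact0 :
  forall x, lambda x = 0 -> exists y, ideal_span I (x - d0 y).
Hypothesis exact1 :
  forall y, ideal_span I (d0 y) -> exists z, ideal_span I (y - d1 z).

(** Here L2 -> L1 -> L0 is the beginning of a lift to A of a free resolution,
    over A/I, of the residue field E = A/m, and lambda is its augmentation.
    Exactness of the resolution is expressed by congruences modulo I L0 and
    I L1. *)
Lemma square_cap_ideal0 x : ideal_pow m 2 x -> x \in I -> x = 0.
Proof.
move=> m2x xI; have [x0 x01] := lambda1.
have [Lambda LambdaE] := free_lift_residue rho_surj lambdaB lambdaZ freeL0.
have Lambda_d0 y : Lambda (d0 y) \in m by rewrite -rho_ker LambdaE lambda_d0.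
(* p x0 is a boundary modulo I L0, and q kills I L0. *)
have [y yE] : exists y, x *: x0 = d0 y.
  elim/ideal_pow2_ind: x / {xI} m2x => [|a p q x pm qm [y yE]].
    by exists 0; rewrite scale0r raddf0.
  have /exact0[z sz] : lambda (p *: x0) = 0.
    by rewrite lambdaZ x01 mulr1; apply/eqP; rewrite rho_ker.
  exists (a *: (q *: z) + y); rewrite scalerDl yE linearD !linearZ /=.
  congr (_ + _); rewrite -scalerA [p * q]mulrC -scalerA; congr (_ *: _).
  by apply/eqP; rewrite -subr_eq0 -scalerBr (ideal_span_killed qm sz).
have [z sz] : exists z, ideal_span I (y - d1 z).
  by apply: exact1; rewrite -yE; apply: ideal_spanZ.
(* Lambda maps boundaries into m, hence I times boundaries to m I = 0. *)
have : Lambda (d0 (y - d1 z)) = 0.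
  elim: sz => [|a u v aI _ IH]; first by rewrite !raddf0.
  rewrite raddfD raddfD /= !linearZ /= IH addr0 -[_ *: _]/(_ * _) mulrC.
  by rewrite mI0 ?Lambda_d0.
rewrite linearB /= dd subr0 -yE linearZ /= => xL0.
have : (Lambda x0 - 1) * x = 0.
  by apply: mI0 xI; rewrite -rho_ker rmorphB rmorph1 LambdaE x01 subrr.
rewrite mulrBl mul1r mulrC -[_ * _]/(_ *: _) xL0 sub0r => /eqP.
by rewrite oppr_eq0 => /eqP.
Qed.

End LiftedResidueField.

(** * Linear independence modulo a subspace *)

Section RelativeIndependence.
Variables (k : fieldType) (V : lmodType k) (U : V -> Prop).
Hypothesis U0 : U 0.
Hypothesis UD : forall x y, U x -> U y -> U (x + y).
Hypothesis UZ : forall a x, U x -> U (a *: x).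

Definition indep_mod (J : finType) (v : J -> V) : Prop :=
  forall c : J -> k, U (\sum_j c j *: v j) -> forall j, c j = 0.

Definition spans_mod (J : finType) (v : J -> V) (P : V -> Prop) : Prop :=
  forall x, P x -> exists c : J -> k, U (x - \sum_j c j *: v j).

Lemma sum_mod (J : finType) (w : J -> V) : (forall j, U (w j)) -> U (\sum_j w j).
Proof. by move=> Uw; elim/big_ind: _. Qed.

(** Steinitz: writing w in terms of v modulo U gives a matrix with more rows
    than columns when w is longer than v, and a nonzero vector of its left
    kernel is a relation of w modulo U. *)
Lemma indep_mod_card (J J' : finType) (v : J -> V) (w : J' -> V) (P : V -> Prop) :
    spans_mod v P -> (forall j, P (w j)) -> indep_mod w ->
  (#|J'| <= #|J|)%N.
Proof.
move=> vP Pw windep; rewrite leqNgt; apply/negP => ltJ.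
have [M ME] := choice (fun j => vP _ (Pw j)).
pose B : 'M[k]_(#|J'|, #|J|) := \matrix_(i, j) M (enum_val i) (enum_val j).
have : kermx B != 0.
  rewrite -mxrank_eq0 mxrank_ker subn_eq0 -ltnNge.
  exact: leq_ltn_trans (rank_leq_col _) ltJ.
case/rowV0Pn=> r /sub_kermxP rB /eqP; apply; apply/rowP => i; rewrite mxE.
pose c j := r 0 (enum_rank j).
suff /(windep c) /(_ (enum_val i)) : U (\sum_j c j *: w j).
  by rewrite /c enum_valK.
have -> : \sum_j c j *: w j =
    \sum_j c j *: (w j - \sum_l M j l *: v l) + \sum_l (\sum_j c j * M j l) *: v l.
  under [X in _ = _ + X]eq_bigr do rewrite scaler_suml.
  rewrite exchange_big -big_split; apply: eq_bigr => j _ /=.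
  under [X in _ = _ + X]eq_bigr do rewrite -scalerA.
  by rewrite -scaler_sumr -scalerDr subrK.
rewrite [X in _ + X]big1 ?addr0 => [|l _]; first by apply: sum_mod => j; apply: UZ.
suff -> : \sum_j c j * M j l = 0 by rewrite scale0r.
have /rowP/(_ (enum_rank l)) := rB; rewrite !mxE => rBl.
apply: etrans rBl.
rewrite (reindex (@enum_val J' predT)) /=; last exact/onW_bij/enum_val_bij.
by apply: eq_bigr => a _; rewrite mxE /c enum_valK enum_rankK.
Qed.

(** A longest family of elements of P independent modulo U also spans P modulo
    U, as it would otherwise be extended by one element. *)
Lemma indep_mod_maximal (P : V -> Prop) (N : nat) :
    (forall (J : finType) (v : J -> V),
       (forall j, P (v j)) -> indep_mod v -> (#|J| <= N)%N) ->
  exists (J : finType) (v : J -> V),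
    [/\ forall j, P (v j), indep_mod v & spans_mod v P].
Proof.
move=> bound.
pose Q n := `[< exists (J : finType) (v : J -> V),
  [/\ #|J| = n, forall j, P (v j) & indep_mod v] >].
have Q0 : exists n, Q n.
  by exists 0%N; apply/asboolP; exists void, (fun j : void => 0); split=> //;
    rewrite ?card_void //; case.
have QN n : Q n -> (n <= N)%N.
  by move=> /asboolP[J [v [<- Pv iv]]]; apply: bound iv.
case: (ex_maxnP Q0 QN) => n /asboolP[J [v [Jn Pv iv]]] nmax.
exists J, v; split=> // x Px; apply: contrapT => nospan.
suff /nmax : Q n.+1 by rewrite ltnn.
apply/asboolP; exists (unit + J)%type, (fun o => if o is inr j then v j else x).
split=> [|[]//|c]; first by rewrite card_sum card_unit Jn.
rewrite big_sumType /= (big_pred1 tt) => [Uc|[]//].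
have cx0 : c (inl tt) = 0.
  apply/eqP/negPn/negP => cx; apply: nospan.
  exists (fun j => - ((c (inl tt))^-1 * c (inr j))).
  have -> : x - \sum_j - ((c (inl tt))^-1 * c (inr j)) *: v j =
      (c (inl tt))^-1 *: (c (inl tt) *: x + \sum_j c (inr j) *: v j).
    rewrite scalerDr scalerA mulVf // scale1r scaler_sumr -sumrN.
    by congr (_ + _); apply: eq_bigr => j _; rewrite scaleNr opprK scalerA.
  exact: UZ.
have := iv (fun j => c (inr j)); rewrite cx0 scale0r add0r in Uc.
by move=> /(_ Uc) cv0 [[]|j].
Qed.

End RelativeIndependence.

(** * Cotangent spaces *)

Section Cotangent.
Variables (k : fieldType) (R : kalg k).
Local Notation m := (kmax R).
Local Notation m2 := (ideal_pow (kmax R) 2).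

Lemma ideal_pow2Z (a : k) x : m2 x -> m2 (a *: x).
Proof. by move=> m2x; rewrite -mulr_algl; apply: ideal_pow2Ml. Qed.

Lemma kmaxZ (a : k) (x : R) : x \in m -> a *: x \in m.
Proof. by move=> xm; rewrite -mulr_algl idealMr. Qed.

Lemma kmax_sum (J : finType) (c : J -> k) (v : J -> R) :
  (forall j, v j \in m) -> \sum_j c j *: v j \in m.
Proof. by move=> vm; apply: rpred_sum => j _; apply: kmaxZ. Qed.

Lemma kmax_scalar (l : k) : (l%:A : R) \in m -> l = 0.
Proof.
move=> lm; apply/eqP/negPn/negP => l0; have := kmaxZ l^-1 lm.
by rewrite scalerA mulVf // scale1r idealr1.
Qed.

(** Generators of the ideal m span m/m^2 over k, because a coefficient in R
    may be replaced by its residue in k modulo m. *)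
Lemma noetherian_cotangent : noetherian R ->
  exists n (s : 'I_n -> R), spans_mod m2 s (fun x => x \in m).
Proof.
move=> /(_ m)[s sm gen]; exists (size s), (fun i => s`_i) => x /gen[c ->].
have [l lE] := choice (fun i => kalg_residueP (c i)).
exists l; rewrite -sumrB; apply: sum_mod => [|? ?|i].
- by constructor.
- exact: ideal_pow2D.
- rewrite -mulr_algl -mulrBl; apply: ideal_pow2M => //.
  exact/sm/mem_nth/ltn_ord.
Qed.

Lemma noetherian_cotangent_bound : noetherian R -> exists N,
  forall (J : finType) (v : J -> R), (forall j, v j \in m) -> indep_mod m2 v ->
  (#|J| <= N)%N.
Proof.
move=> /noetherian_cotangent[n [s ss]]; exists n => J v vm iv.
rewrite -[n]card_ord; apply: indep_mod_card ss vm iv.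
- by constructor.
- exact: ideal_pow2D.
- exact: ideal_pow2Z.
Qed.

Variable I : idealr R.
Hypothesis sIm : {subset I <= m}.

(** The subspace m^2 + I. *)
Definition square_plus (x : R) : Prop := exists2 y, y \in I & m2 (x - y).

Lemma m2_square_plus x : m2 x -> square_plus x.
Proof. by exists 0; rewrite ?rpred0 ?subr0. Qed.

Lemma square_plusZ (a : k) x : square_plus x -> square_plus (a *: x).
Proof.
move=> [y yI xy]; exists (a *: y); first by rewrite -mulr_algl idealMr.
by rewrite -scalerBr; apply: ideal_pow2Z.
Qed.

Lemma indep_mod_sub (U W : R -> Prop) (J : finType) (v : J -> R) :
  (forall x, U x -> W x) -> indep_mod W v -> indep_mod U v.
Proof. by move=> UW iv c /UW/iv. Qed.

(** A basis of m/(m^2 + I), which is the cotangent space of R/I. *)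
Lemma cotangent_basis_quot : noetherian R ->
  exists (J : finType) (b : J -> R), [/\ forall j, b j \in m,
    indep_mod square_plus b & spans_mod square_plus b (fun x => x \in m)].
Proof.
move=> /noetherian_cotangent_bound[N bound].
apply: (@indep_mod_maximal _ _ _ square_plusZ _ N) => J v vm.
by move/(indep_mod_sub m2_square_plus); apply: bound.
Qed.

(** A basis of I/(I /\ m^2). *)
Lemma cotangent_basis_ideal : noetherian R ->
  exists (J : finType) (b : J -> R), [/\ forall j, b j \in I,
    indep_mod m2 b & spans_mod m2 b (fun x => x \in I)].
Proof.
move=> /noetherian_cotangent_bound[N bound].
apply: (@indep_mod_maximal _ _ _ ideal_pow2Z _ N) => J v vm.
by apply: bound => j; apply: sIm.
Qed.

End Cotangent.

Section TrivialExtensionCotangent.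
Variables (k : fieldType) (B : kalg k) (M : lmodType B).
Hypothesis mM0 : forall (b : B) (x : M), b \in kmax B -> b *: x = 0.

(** The square of the maximal ideal of the trivial extension B |x M is the
    square of that of B: it has no component in M, as m_B M = 0. *)
Lemma trivext_square (x : trivext_kalg M) :
  ideal_pow (kmax (trivext_kalg M)) 2 x -> ideal_pow (kmax B) 2 x.1 /\ x.2 = 0.
Proof.
elim/ideal_pow2_ind: x / => [|a p q x pm qm [x1 x2]].
  by split=> //; constructor.
split; first exact: ideal_pow2_add_mul.
rewrite -[LHS]/((a * (p * q)).2 + x.2) x2 trivext_mul_snd trivext_mul_fst.
rewrite trivext_mul_snd [p.1 *: _]mM0 // [q.1 *: _]mM0 // [_ *: a.2]mM0.
  by rewrite !addr0 scaler0.
exact: idealMr.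
Qed.

End TrivialExtensionCotangent.

(** * Square-zero extensions: the dimension count and the section *)

Lemma kalg_hom_square (k : fieldType) (R S : kalg k) (f : kalg_hom R S) x :
  ideal_pow (kmax R) 2 x -> ideal_pow (kmax S) 2 (f x).
Proof.
elim/ideal_pow2_ind: x / => [|a p q x pm qm fx].
  by rewrite rmorph0; constructor.
by rewrite rmorphD !rmorphM; apply: ideal_pow2_add_mul => //; apply: khom_max.
Qed.

Section SquareZeroExtension.
Variables (k : fieldType) (R : kalg k) (I : idealr R).
Hypothesis sIm : {subset I <= kmax R}.
Hypothesis mI0 : forall x y : R, x \in kmax R -> y \in I -> x * y = 0.
Local Notation m2 := (ideal_pow (kmax R) 2).
Local Notation Rbar := (quot_kalg sIm).
Local Notation pi := (quot_pi sIm).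
Local Notation Ibar := (quot_ideal sIm mI0 : lmodType Rbar).

Definition to_Ibar (x : R) (xI : x \in I) : Ibar := exist _ x xI.
Definition of_Ibar (y : Ibar) : R := sval (y : ideal_of I).

Lemma to_IbarK x (xI : x \in I) : of_Ibar (to_Ibar xI) = x.
Proof. by []. Qed.

Lemma of_IbarI y : of_Ibar y \in I.
Proof. exact: valP (y : ideal_of I). Qed.

Lemma of_Ibar_inj : injective of_Ibar.
Proof. exact: (@val_inj _ _ (ideal_of I)). Qed.

Lemma of_IbarD y z : of_Ibar (y + z) = of_Ibar y + of_Ibar z.
Proof. by []. Qed.

Lemma of_Ibar_sum (J : finType) (y : J -> Ibar) :
  of_Ibar (\sum_j y j) = \sum_j of_Ibar (y j).
Proof. by elim/big_rec2: _ => // j a b _ <-. Qed.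

Lemma of_IbarZ a y : of_Ibar (pi a *: y) = a * of_Ibar y.
Proof. by rewrite [_ *: y]quot_scaleE. Qed.

Lemma of_IbarZk (l : k) y : of_Ibar (l%:A *: y) = l *: of_Ibar y.
Proof. by rewrite -[l%:A](rmorph_alg pi) of_IbarZ mulr_algl. Qed.

Lemma pi_surj q : exists x, pi x = q.
Proof. by exists (repr q); apply: reprK. Qed.

Lemma pi_eq x y : (pi x == pi y) = (x - y \in I).
Proof. by rewrite Quotient.idealrBE. Qed.

Lemma pi_max x : (pi x \in kmax Rbar) = (x \in kmax R).
Proof. exact: quot_maxE. Qed.

Lemma Ibar_killed (b : Rbar) (y : Ibar) : b \in kmax Rbar -> b *: y = 0.
Proof.
have [x <-] := pi_surj b; rewrite pi_max => xm; apply: of_Ibar_inj.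
by rewrite of_IbarZ mI0 ?of_IbarI.
Qed.

Lemma pi_square x : ideal_pow (kmax Rbar) 2 (pi x) -> square_plus I x.
Proof.
move=> m2x; suff: exists2 y, m2 y & pi x = pi y.
  move=> [y m2y /eqP]; rewrite pi_eq => xyI.
  by exists (x - y) => //; rewrite subKr.
elim/ideal_pow2_ind: {x}(pi x) / m2x => [|a p q b pm qm [y m2y ->]].
  by exists 0; rewrite ?rmorph0 //; constructor.
move: pm qm; have [a' <-] := pi_surj a; have [p' <-] := pi_surj p.
have [q' <-] := pi_surj q; rewrite !pi_max => pm qm.
exists (a' * (p' * q') + y); first exact: ideal_pow2_add_mul.
by rewrite rmorphD !rmorphM.
Qed.

(** Suppose w <> 0 in I /\ m^2.  Bases b of m/(m^2 + I) and y of I/(I /\ m^2)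
    together span m/m^2.  In the trivial extension, on the other hand, the
    elements (pi b, 0), (0, w) and (0, y) are independent modulo the square of
    the maximal ideal, and the isomorphism carries them to a family of m
    independent modulo m^2 with one element too many. *)
Lemma square_cap_ideal0_of_iso : noetherian R ->
  kalg_iso R (trivext_kalg Ibar) -> forall x, m2 x -> x \in I -> x = 0.
Proof.
move=> noethR [f [g [fK gK]]] w m2w wI.
have [J1 [b [bm bindep bspan]]] := cotangent_basis_quot I noethR.
have [J2 [y [yI yindep yspan]]] := cotangent_basis_ideal sIm noethR.
apply/eqP/negPn/negP => w0.
pose v (j : J1 + J2) := match j with inl j => b j | inr j => y j end.
have vspan : spans_mod m2 v (fun x => x \in kmax R).
  move=> x /bspan[c [z /yspan[d zd] xc]].
  exists (fun j => match j with inl j => c j | inr j => d j end).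
  rewrite big_sumType /=; have := ideal_pow2D xc zd.
  by rewrite addrA subrK opprD addrA.
pose t (j : J1 + (unit + J2)) : trivext_kalg Ibar := match j with
  | inl j => (pi (b j), 0) | inr (inl _) => (0, to_Ibar wI)
  | inr (inr j) => (0, to_Ibar (yI j)) end.
have tm j : g (t j) \in kmax R.
  apply: khom_max; case: j => [j|[j|j]] /=; last 2 first.
  - exact: (rpred0 (kmax Rbar)).
  - exact: (rpred0 (kmax Rbar)).
  by rewrite [_ \in _]pi_max.
suff tindep : indep_mod m2 (fun j => g (t j)).
  have := indep_mod_card (IdealPow0 _ 2) (@ideal_pow2D _ _) (@ideal_pow2Z _ R)
    vspan tm tindep.
  by rewrite !card_sum card_unit addnCA ltnn.
move=> c /(kalg_hom_square f); rewrite linear_sum.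
under eq_bigr do rewrite linearZ /= gK.
move=> /(trivext_square Ibar_killed)[].
rewrite (big_morph _ (fun x y : trivext_kalg Ibar => erefl (x + y).1) erefl).
rewrite (big_morph _ (fun x y : trivext_kalg Ibar => erefl (x + y).2) erefl).
rewrite !big_sumType /= !(big_pred1 tt); try by case.
set z := (X in _ + X); have -> : z = 0.
  by rewrite /z scaler0 big1 ?addr0 // => j _; rewrite scaler0.
rewrite {z} addr0 [X in X + _]big1 ?add0r => [m2b|j _]; last exact: scaler0.
move=> /(congr1 of_Ibar); rewrite of_IbarD of_Ibar_sum of_IbarZk.
under eq_bigr do rewrite of_IbarZk; rewrite /of_Ibar /= => wy0.
have c1 : forall j, c (inl j) = 0.
  apply: bindep; apply: pi_square; rewrite linear_sum.
  by under eq_bigr do rewrite linearZ.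
have c2 : forall j, c (inr (inr j)) = 0.
  apply: yindep; move/eqP: wy0; rewrite addrC addr_eq0 => /eqP ->.
  by rewrite -scaleNr; apply: ideal_pow2Z.
move: wy0; rewrite big1 => [|j _]; last by rewrite c2 scale0r.
by rewrite addr0 => /eqP; rewrite scaler_eq0 (negPf w0) orbF => /eqP ? [j|[[]|j]].
Qed.

Section Subalgebra.
Variable C : R -> Prop.
Hypothesis C1 : C 1.
Hypothesis CZD : forall (a : k) x y, C x -> C y -> C (a *: x + y).
Hypothesis CM : forall x y, C x -> C y -> C (x * y).
Hypothesis CI : forall x, C x -> x \in I -> x = 0.
Hypothesis CS : forall x, exists2 y, C y & x - y \in I.

(** A subalgebra C of R complementary to I is mapped isomorphically onto R/I
    by pi; the section is the inverse of this isomorphism. *)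
Lemma subalgebra_section : exists f : kalg_hom Rbar R, is_section f pi.
Proof.
have lift q : exists x, C x /\ pi x = q.
  have [x <-] := pi_surj q; have [y Cy xy] := CS x; exists y; split=> //.
  by apply/esym/eqP; rewrite pi_eq.
have [s sP] := choice lift.
have sC q : C (s q) by case: (sP q).
have sK : cancel s pi by move=> q; case: (sP q).
have sE x : C x -> s (pi x) = x.
  move=> Cx; apply/eqP; rewrite -subr_eq0; apply/eqP/CI.
    by rewrite addrC -scaleN1r; apply: CZD.
  by rewrite -pi_eq sK.
have slin : linear s.
  move=> a p q; have <- : pi (a *: s p + s q) = a *: p + q.
    by rewrite linearP /= !sK.
  exact/sE/CZD.
have smul : monoid_morphism s.
  split; first by rewrite -(rmorph1 pi) sE.
  move=> p q; have <- : pi (s p * s q) = p * q by rewrite rmorphM /= !sK.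
  exact/sE/CM.
pose Bl := GRing.isLinear.Build k Rbar R *:%R s slin.
pose Bm := GRing.isMonoidMorphism.Build Rbar R s smul.
pose sl : {lrmorphism Rbar -> R} := HB.pack s Bl Bm.
have smax q : q \in kmax Rbar -> sl q \in kmax R.
  by move=> qm; rewrite -pi_max /= sK.
exists (KAlgHom smax); split=> //; first exact: (can_inj sK).
exact: pi_surj.
Qed.
End Subalgebra.

(** The subalgebra complementary to I is C = k + N, where N is the span of m^2
    and of a basis b of m/(m^2 + I); C is closed under products because N
    contains m^2. *)
Lemma section_of_square_cap_ideal0 : noetherian R ->
    (forall x, m2 x -> x \in I -> x = 0) ->
  exists f : kalg_hom Rbar R, is_section f pi.
Proof.
move=> noethR m2I0; have [J [b [bm bindep bspan]]] := cotangent_basis_quot I noethR.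
pose N x := exists c : J -> k, m2 (x - \sum_j c j *: b j).
have Nm x : N x -> x \in kmax R.
  move=> [c /ideal_pow2_sub xc]; rewrite -(subrK (\sum_j c j *: b j) x).
  by rewrite rpredD ?kmax_sum.
have m2N x : m2 x -> N x.
  exists (fun=> 0); rewrite big1 ?subr0 // => j _; exact: scale0r.
have NZD (a : k) x y : N x -> N y -> N (a *: x + y).
  move=> [c xc] [d yd]; exists (fun j => a * c j + d j).
  have -> : \sum_j (a * c j + d j) *: b j =
      a *: \sum_j c j *: b j + \sum_j d j *: b j.
    rewrite scaler_sumr -big_split; apply: eq_bigr => j _ /=.
    by rewrite scalerDl scalerA.
  by rewrite opprD addrACA -scalerBr; apply: ideal_pow2D => //; apply: ideal_pow2Z.
have N0 : N 0 by apply: m2N; constructor.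
pose C x := exists l : k, N (x - l%:A).
apply: (@subalgebra_section C).
- by exists 1; rewrite scale1r subrr.
- move=> a x y [l xl] [l' yl]; exists (a * l + l').
  by rewrite scalerDl -scalerA opprD addrACA -scalerBr; apply: NZD.
- move=> x y [l xl] [l' yl]; exists (l * l').
  (* (l + n)(l' + n') = l l' + l n' + l' n + n n', and n n' is in m^2. *)
  have -> : x * y - (l * l')%:A = l *: (y - l'%:A) + (l' *: (x - l%:A) +
      (1 *: ((x - l%:A) * (y - l'%:A)) + 0)).
    rewrite -[l *: (y - _)]mulr_algl -[l' *: (x - _)]mulr_algl -[in (l * l')%:A]scalerA.
    rewrite -[l *: (l' *: _)]mulr_algl scale1r addr0; set p := l%:A; set q := l'%:A.
    by ring.
  by do 3!apply: (NZD) => //; apply/m2N/ideal_pow2M; apply: Nm.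
- move=> x [l xl] xI; have l0 : l = 0.
    apply: (@kmax_scalar _ R); rewrite -[_%:A](subKr x) rpredB ?(sIm xI) //.
    exact: Nm.
  move: xl; rewrite l0 scale0r subr0 => -[c xc].
  apply: m2I0 => //; rewrite -[x](subrK (\sum_j c j *: b j)).
  apply: ideal_pow2D => //; rewrite big1; first by constructor.
  move=> j _; rewrite (bindep c) ?scale0r //; exists x => //.
  by rewrite -opprB -scaleN1r; apply: ideal_pow2Z.
move=> x; have [l xl] := kalg_residueP x; have [c [y yI xy]] := bspan _ xl.
exists (x - y); last by rewrite subKr.
exists l, c; suff -> : x - y - l%:A - \sum_j c j *: b j =
  x - l%:A - \sum_j c j *: b j - y by [].
by ring.
Qed.

End SquareZeroExtension.

(** * Decompositions as trivial extensions and semi-fiber products *)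

(** The inverse respects the maximal ideals automatically: an element l + y,
    with l in k and y in the maximal ideal, has an image in the maximal ideal
    only if l = 0. *)
Lemma kalg_iso_of_bijective (k : fieldType) (R S : kalg k) (g : S -> R) :
    linear g -> monoid_morphism g -> (forall x, x \in kmax S -> g x \in kmax R) ->
    bijective g ->
  kalg_iso R S.
Proof.
move=> glin gmul gmax [h gK hK].
have hlin : linear h.
  by move=> a x y; apply: (can_inj gK); rewrite glin !hK.
have hmul : monoid_morphism h.
  split; first by apply: (can_inj gK); rewrite hK gmul.1.
  by move=> x y; apply: (can_inj gK); rewrite gmul.2 !hK.
pose gl : {lrmorphism S -> R} := HB.pack g
  (GRing.isLinear.Build k S R *:%R g glin) (GRing.isMonoidMorphism.Build S R g gmul).
pose hl : {lrmorphism R -> S} := HB.pack h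
  (GRing.isLinear.Build k R S *:%R h hlin) (GRing.isMonoidMorphism.Build R S h hmul).
have hmax x : x \in kmax R -> hl x \in kmax S.
  move=> xm; have [l xl] := kalg_residueP (hl x).
  suff l0 : l = 0 by rewrite l0 scale0r subr0 in xl.
  apply: (@kmax_scalar _ R).
  have -> : l%:A = x - gl (hl x - l%:A) by rewrite linearB linearZ rmorph1 /= hK subKr.
  by rewrite rpredB //; apply: gmax.
by exists (KAlgHom hmax), (@KAlgHom _ _ _ gl gmax).
Qed.

Lemma trivext_sfprod_iso (k : fieldType) (B : kalg k) (M : lmodType B) :
  kalg_iso (trivext_kalg M) (sfprod_kalg (ktrivext_action M)).
Proof.
pose g (x : sfprod_kalg (ktrivext_action M)) : trivext_kalg M :=
  (x.1, ktrivext_out x.2).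
apply: (@kalg_iso_of_bijective _ _ _ g).
- move=> a [x y] [x' y']; congr (_, _) => /=.
  rewrite ktrivext_outD ktrivext_outZ; congr (_ *: _ + _).
  exact: (congr1 (in_alg B) (mulr1 a)).
- split=> // -[x y] [x' y']; congr (_, _) => /=.
  rewrite !ktrivext_outD ktrivext_outZ !ktrivext_inK.
  have /eqP -> := valP y; by rewrite rmorph0 scale0r addr0.
- by move=> [x y].
exists (fun x : trivext_kalg M => (x.1, ktrivext_in x.2)).
  by move=> [x y]; rewrite /g /= ktrivext_outK.
by move=> [x y].
Qed.

(** The isomorphism is (b, y) |-> f b + y; it is multiplicative since
    I^2 = 0. *)
Lemma trivext_iso_of_section (k : fieldType) (R : kalg k) (I : idealr R)
    (sIm : {subset I <= kmax R})
    (mI0 : forall x y : R, x \in kmax R -> y \in I -> x * y = 0)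
    (f : kalg_hom (quot_kalg sIm) R) :
  is_section f (quot_pi sIm) ->
  kalg_iso R (trivext_kalg (quot_ideal sIm mI0 : lmodType (quot_kalg sIm))).
Proof.
move=> [_ _ fK]; set pi := quot_pi sIm in fK.
have fI x : x - f (pi x) \in I by rewrite -(pi_eq sIm) -/pi fK.
pose T := trivext_kalg (quot_ideal sIm mI0 : lmodType (quot_kalg sIm)).
pose g (x : T) : R := f x.1 + of_Ibar x.2.
have fM (b : quot_kalg sIm) (y : quot_ideal sIm mI0) :
    of_Ibar (b *: y) = f b * of_Ibar y.
  by rewrite -{1}[b]fK of_IbarZ.
have pi_Ibar (y : quot_ideal sIm mI0) : pi (of_Ibar y) = 0.
  by apply/eqP; rewrite -[0](rmorph0 pi) pi_eq subr0 of_IbarI.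
apply: (@kalg_iso_of_bijective _ _ _ g).
- move=> a [x y] [x' y'].
  have -> : g (a *: ((x, y) : T) + (x', y')) =
    f (a *: x + x') + of_Ibar ((a%:A : quot_kalg sIm) *: y + y') by [].
  by rewrite /g linearP of_IbarD of_IbarZk scalerDr addrACA.
- split; first by rewrite /g /= rmorph1 addr0.
  move=> [x y] [x' y'].
  have -> : g (((x, y) : T) * (x', y')) = f (x * x') + of_Ibar (x *: y' + x' *: y).
    by [].
  rewrite /g rmorphM of_IbarD !fM.
  have : of_Ibar y * of_Ibar y' = 0 by rewrite mI0 ?of_IbarI ?sIm ?of_IbarI.
  set p := of_Ibar y; set q := of_Ibar y' => pq0.
  by rewrite mulrDl !mulrDr pq0 addr0 addrA [p * _]mulrC.
- move=> [x y] /= xm; apply: rpredD; last exact/sIm/of_IbarI.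
  exact: khom_max.
exists (fun x => (pi x, to_Ibar sIm mI0 (fI x)) : T).
  move=> [x y]; have e : pi (g (x, y)) = x.
    by rewrite /g rmorphD /= fK pi_Ibar addr0.
  apply: (congr2 pair) => //; apply: of_Ibar_inj; rewrite to_IbarK e.
  by rewrite /g addrC addKr.
by move=> x; rewrite /g to_IbarK addrC subrK.
Qed.

(** * Base change of free modules *)

Section FreeBaseChange.
Variables (A S : comNzRingType) (phi : {rmorphism A -> S}) (K : choiceType).

Definition freeg_change : {linear {freeg K / A} -> restr phi {freeg K / S}} :=
  free_lift (fun x => << x >> : restr phi {freeg K / S}).

Lemma freeg_changeZU a x :
  freeg_change (a *: << x >>) = phi a *: << x >> :> {freeg K / S}.
Proof. by rewrite linearZ /= free_liftU. Qed.

Lemma freeg_changeB u v :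
  freeg_change (u - v) = freeg_change u - freeg_change v :> {freeg K / S}.
Proof. exact: (raddfB freeg_change). Qed.

Lemma freeg_changeU x : freeg_change << x >> = << x >> :> {freeg K / S}.
Proof. by rewrite /= free_liftU. Qed.

Local Notation T := (tensor phi ({freeg K / A} : lmodType A)).

Definition freeg_of_tensor : {linear T -> {freeg K / S}} := tensor_desc freeg_change.

Definition tensor_of_freeg : {linear {freeg K / S} -> T} :=
  free_lift (fun x => pure_tensor phi (<< x >> : {freeg K / A}) 1).

Lemma freeg_of_tensor_pure x s :
  freeg_of_tensor (pure_tensor phi x s) = s *: (freeg_change x : {freeg K / S}).
Proof. exact: tensor_desc_pure. Qed.

Lemma tensor_of_freeg_change x :
  tensor_of_freeg (freeg_change x) = pure_tensor phi x 1.
Proof.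
move: x; apply: freeg_ext => [x y|x y|a x]; first by rewrite !raddfB.
  exact: pure_tensorB.
rewrite freeg_changeZU linearZ /= free_liftU.
by rewrite scale_pure_tensor pure_tensorZ.
Qed.

Lemma freeg_of_tensor_bij : bijective freeg_of_tensor.
Proof.
exists tensor_of_freeg => [q|u].
  apply: (@tensor_linear_ext _ _ phi {freeg K / A} T
    (tensor_of_freeg \o freeg_of_tensor) idfun) => x /=.
  by rewrite freeg_of_tensor_pure scale1r tensor_of_freeg_change.
apply: (@free_linear_ext _ _ _ (freeg_of_tensor \o tensor_of_freeg) idfun) => x /=.
by rewrite free_liftU freeg_of_tensor_pure scale1r freeg_changeU.
Qed.

End FreeBaseChange.

(** * Free resolutions and their lifts *)

Section LiftAlongSection.
Variables (A S : comNzRingType) (phi : {rmorphism A -> S}) (f : {rmorphism S -> A}).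
Hypothesis fK : cancel f phi.

Lemma freeg_changeK (K : choiceType) (u : {freeg K / S}) :
  freeg_change phi K (freeg_change f K u) = u.
Proof.
move: u; apply: freeg_ext => [u v|//|a x]; first by rewrite !raddfB.
by rewrite !freeg_changeZU fK.
Qed.

Section Differential.
Variables (K K' : choiceType) (d : {linear {freeg K' / S} -> {freeg K / S}}).

(** The differential with the matrix of d, its entries mapped by f. *)
Definition lift_diff : {linear {freeg K' / A} -> {freeg K / A}} :=
  free_lift (fun x => freeg_change f K (d << x >>) : {freeg K / A}).

Lemma lift_diff_section u :
  lift_diff (freeg_change f K' u) = freeg_change f K (d u).
Proof.
move: u; apply: freeg_ext => [u v|u v|a x].
- by rewrite freeg_changeB linearB.
- by rewrite linearB freeg_changeB.
- by rewrite freeg_changeZU linearZ /= free_liftU [in RHS]linearZ /= linearZ.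
Qed.

Lemma lift_diff_retract u :
  freeg_change phi K (lift_diff u) = d (freeg_change phi K' u).
Proof.
move: u; apply: freeg_ext => [u v|u v|a x].
- by rewrite linearB freeg_changeB.
- by rewrite freeg_changeB linearB.
- rewrite freeg_changeZU linearZ /= free_liftU [in LHS]linearZ linearZ /=.
  by rewrite freeg_changeK.
Qed.

End Differential.

(** The same bases over A and the matrices of the differentials transported by
    f define a complex again, as f is a ring homomorphism, and it reduces to
    the given one because phi o f = id. *)
Lemma free_complex_liftable (K : int -> choiceType)
    (d : forall n : int, {linear {freeg (K (n + 1)) / S} -> {freeg (K n) / S}})
    (dd : forall n x, d n (d (n + 1) x) = 0) :
  complex_liftable phi (@Complex S (fun n => {freeg (K n) / S}) d dd).
Proof.
have ddL n x : lift_diff (d n) (lift_diff (d (n + 1)) x) = 0.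
  move: x; apply: freeg_ext => [u v|u v|a x]; rewrite ?subr0 //.
    by rewrite !linearB.
  rewrite !linearZ /= free_liftU lift_diff_section dd.
  by rewrite [freeg_change _ _ 0]raddf0 scaler0.
exists (@Complex A (fun n => {freeg (K n) / A})
  (fun n => lift_diff (d n)) ddL); split=> [n|]; first exact: free_freeg.
exists (fun n => freeg_of_tensor phi (K n)); split=> [n|n q].
  exact: freeg_of_tensor_bij.
move: q; apply: tensor_additive_ext => [p q|p q|x s].
- by rewrite !linearB.
- by rewrite !linearB.
rewrite /= tensor_map_pure !freeg_of_tensor_pure linearZ /=; congr (_ *: _).
exact: lift_diff_retract.
Qed.

End LiftAlongSection.

Section FreeResolution.
Variables (A : comNzRingType) (M : lmodType A).

(** A set of generators large enough to map onto M and onto the free module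
    which it generates.  With it one and the same free module G serves in all
    nonnegative degrees of a free resolution of M: G surjects onto M, and onto
    every submodule of G.  A tree encodes either an element of M (a leaf) or a
    linear combination of trees (a node whose children are pairs of a
    coefficient and a tree). *)
Definition tree : choiceType := GenTree.tree (A + M)%type.
Local Notation G := {freeg tree / A}.

Definition tree_term (t : tree) : G :=
  if t is GenTree.Node _ [:: GenTree.Leaf (inl a); t'] then << a *g t' >> else 0.

Definition tree_chain (t : tree) : G :=
  if t is GenTree.Node _ ts then \sum_(t' <- ts) tree_term t' else 0.

Definition tree_elt (t : tree) : M := if t is GenTree.Leaf (inr x) then x else 0.

Lemma tree_chain_surj u : exists t, tree_chain t = u.
Proof.
exists (GenTree.Node 0 [seq GenTree.Node 0 [:: GenTree.Leaf (inl (coeff x u)); x]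
  | x <- dom u]).
by rewrite /= big_map -[RHS](freeg_sumE u).
Qed.

(** The image is the whole kernel of h, because every element of G is coded by
    some generator. *)
Definition onto_ker (N : lmodType A) (h : {linear G -> N}) : {linear G -> G} :=
  free_lift (fun t => if h (tree_chain t) == 0 then tree_chain t else 0).

Lemma onto_kerP (N : lmodType A) (h : {linear G -> N}) u :
  h u = 0 <-> exists v, u = onto_ker h v.
Proof.
split=> [hu0|[v ->]].
  have [t tE] := tree_chain_surj u; exists << t >>.
  by rewrite /onto_ker /= free_liftU tE hu0 eqxx.
apply: (@free_linear_ext _ _ _ (h \o onto_ker h) \0) => t /=.
by rewrite /onto_ker /= free_liftU; case: eqP; rewrite ?raddf0.
Qed.

Definition tree_aug : {linear G -> M} := free_lift tree_elt.

Fixpoint tree_diff (n : nat) : {linear G -> G} :=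
  if n is n'.+1 then onto_ker (tree_diff n') else onto_ker tree_aug.

(** The zero module in negative degrees is the free module on the empty set. *)
Definition res_basis (n : int) : choiceType := if n is Posz _ then tree else void.

Definition res_diff (n : int) :
    {linear {freeg (res_basis (n + 1)) / A} -> {freeg (res_basis n) / A}} :=
  match n with Posz n' => tree_diff n' | Negz _ => \0 end.

Lemma res_neg (n : int) (u : {freeg (res_basis n) / A}) : (n < 0)%R -> u = 0.
Proof. by case: n u => // n u _; apply/eqP/freeg_eqP => -[]. Qed.

Lemma res_exact (n : int) (u : {freeg (res_basis (n + 1)) / A}) : (0 <= n)%R ->
  res_diff n u = 0 <-> exists v, u = res_diff (n + 1) v.
Proof.
case: n u => // n u _.
change (tree_diff n u = 0 <-> exists v, u = tree_diff (n + 1) v).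
by rewrite addn1; apply: onto_kerP.
Qed.

Lemma res_dd (n : int) x : res_diff n (res_diff (n + 1) x) = 0.
Proof.
case: n x => [n|n] x; last exact: res_neg.
by apply/res_exact => //; exists x.
Qed.

Definition resolution : complex A :=
  @Complex A (fun n => {freeg (res_basis n) / A}) res_diff res_dd.

Lemma resolutionP : free_resolution resolution M.
Proof.
split=> [n|n n0 x|n n0 x|].
- exact: free_freeg.
- exact: res_neg.
- exact: res_exact.
exists tree_aug; split=> [x|x]; last exact: onto_kerP.
by exists << (GenTree.Leaf (inr x) : tree) >>; rewrite /tree_aug /= free_liftU.
Qed.
End FreeResolution.

(** * The equivalence *)

(** This transports exactness of the resolution of k, through the isomorphism
    with the reduction of L, to congruences modulo I L_n, and then applies
    [square_cap_ideal0]. *)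
Lemma square_cap_ideal0_of_liftable (k : fieldType) (R : kalg k) (I : idealr R)
    (sIm : {subset I <= kmax R})
    (mI0 : forall x y : R, x \in kmax R -> y \in I -> x * y = 0) :
  module_liftable (quot_pi sIm) (residue_module (quot_kalg sIm)) ->
  forall x, ideal_pow (kmax R) 2 x -> x \in I -> x = 0.
Proof.
pose pi : {rmorphism R -> {ideal_quot I}} := \pi_{ideal_quot I}.
(* The tensor lemmas speak of the bare projection of rings, to which the
   underlying map of the algebra homomorphism is convertible. *)
change (module_liftable pi (residue_module (quot_kalg sIm)) ->
  forall x, ideal_pow (kmax R) 2 x -> x \in I -> x = 0).
move=> [F [[_ _ Fexact [eps [eps_surj eps_ker]]] [L [freeL [h [hbij hd]]]]]].
pose E := {ideal_quot (kmax (quot_kalg sIm))}.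
pose rho : {rmorphism R -> E} := \pi_E \o pi.
have rho_surj e : exists a, rho a = e.
  by exists (repr (repr e)); rewrite /rho /= !reprK.
have rho_ker a : (rho a == 0) = (a \in kmax R).
  by rewrite /rho /= ideal_quot_eq0 [_ \in _]pi_max.
pose u n x := h n (pure_tensor pi x 1).
have uB n x y : u n (x - y) = u n x - u n y.
  by rewrite /u pure_tensorB; apply: (raddfB (h n)).
have u_surj n z : exists x, u n x = z.
  have [g _ gK] := hbij n; have [x xE] := tensor_quot_surj (g z).
  by exists x; rewrite /u -xE gK.
have u_ker n x : u n x = 0 -> ideal_span I x.
  move=> ux0; apply: tensor_quot_eq0; apply: (bij_inj (hbij n)).
  by rewrite -/(u n x) ux0; apply/esym/(raddf0 (h n)).
have u_span n x : ideal_span I x -> u n x = 0.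
  by move=> sx; rewrite /u (tensor_quot_span sx); apply: (raddf0 (h n)).
have ud n y : u n (cx_d L n y) = cx_d F n (u (n + 1) y).
  by rewrite /u -hd; congr (h n _); apply/esym/tensor_map_pure.
pose lambda (x : L 0) : E := eps (u 0 x).
have lambdaB : zmod_morphism lambda.
  by move=> x y; rewrite /lambda uB (raddfB eps).
have lambdaZ a x : lambda (a *: x) = rho a * lambda x.
  rewrite /lambda; have -> : u 0 (a *: x) = pi a *: u 0 x.
    by rewrite /u pure_tensorZ -scale_pure_tensor; apply: (linearZZ (h 0)).
  exact: (linearZZ eps).
have lambda1 : exists x, lambda x = 1.
  have [z z1] := eps_surj (1 : E); have [x xz] := u_surj 0 z.
  by exists x; rewrite /lambda xz.
apply: (@square_cap_ideal0 _ _ (kmax R) I mI0 rho rho_surj rho_ker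
  (L 0) (L (0 + 1)) (L (0 + 1 + 1)) (cx_d L 0) (cx_d L (0 + 1)) lambda lambdaB lambdaZ).
- exact: freeL.
- exact: cx_dd.
- exact: lambda1.
- by move=> y; apply/eps_ker; rewrite ud; exists (u (0 + 1) y).
- move=> x /eps_ker[z xz]; have [y yz] := u_surj (0 + 1) z; exists y.
  by apply: (u_ker 0); rewrite uB ud yz xz subrr.
move=> y /u_span; rewrite ud => /Fexact[//|z yz]; have [w wz] := u_surj (0 + 1 + 1) z.
by exists w; apply: (u_ker (0 + 1)); rewrite uB ud wz yz subrr.
Qed.

Lemma residue_module_fg (k : fieldType) (R : kalg k) : fg_module (residue_module R).
Proof.
exists [:: (1 : {ideal_quot (kmax R)}^o)] => x.
exists (fun=> repr (x : {ideal_quot (kmax R)})).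
rewrite big_ord1 /=; change (x = \pi_{ideal_quot (kmax R)} (repr x) * 1).
by rewrite mulr1 reprK.
Qed.

Theorem corollary3p12 (k : fieldType) (R : kalg k)
    (noethR : noetherian R) (complR : adically_complete (kmax R))
    (localR : local_kalg R)
    (I : idealr R) (sIm : {subset I <= kmax R})
    (mI0 : forall x y : R, x \in kmax R -> y \in I -> x * y = 0) :
  let Rbar := quot_kalg sIm in
  let pi := quot_pi sIm in
  let Ibar : lmodType Rbar := quot_ideal sIm mI0 in
  [<-> module_liftable pi (residue_module Rbar);
       (forall M : lmodType Rbar, fg_module M -> module_liftable pi M);
       (exists f : kalg_hom Rbar R, is_section f pi);
       (kalg_iso R (trivext_kalg Ibar) /\
        kalg_iso (trivext_kalg Ibar) (sfprod_kalg (ktrivext_action Ibar)))].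
Proof.
move=> Rbar pi Ibar.
have section_lift (f : kalg_hom Rbar R) (M : lmodType Rbar) :
    is_section f pi -> module_liftable pi M.
  move=> [_ _ fK]; exists (resolution M); split; first exact: resolutionP.
  exact: (free_complex_liftable (phi := pi) (f := f) fK).
have lift_section :
    module_liftable pi (residue_module Rbar) ->
    exists f : kalg_hom Rbar R, is_section f pi.
  by move=> /(square_cap_ideal0_of_liftable mI0); apply: section_of_square_cap_ideal0.
tfae.
- by move=> /lift_section[f fs] M _; apply: section_lift fs.
- by move=> /(_ _ (residue_module_fg Rbar)); apply: lift_section.
- move=> [f fs]; split; last exact: trivext_sfprod_iso.
  exact: trivext_iso_of_section fs.
move=> [/(square_cap_ideal0_of_iso noethR)].
by move=> /(section_of_square_cap_ideal0 sIm noethR)[f fs] _; apply: section_lift fs.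
Qed.
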